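(* Let $\Gamma$ be a finite simplicial graph whose vertex set is given an arbitrary indexing $V=\{v_1,\dots,v_n\}$, let $A_\Gamma$ be the associated right-angled Artin group, and let $1\le k\le n$. The stabiliser subgroup $\Pi\mathrm{A}_\Gamma(k)$, consisting of the elements of $\Pi\mathrm{A}_\Gamma$ that fix each of $v_1,\dots,v_k$, is generated by the set of diagram automorphisms, inversions and dominated elementary palindromic automorphisms that fix each of $v_1,\dots,v_k$.
   Context: $A_\Gamma$ is the group with generating set $V$ and relations $[v_i,v_j]=1$ whenever $v_i,v_j$ are joined by an edge of $\Gamma$. $\Pi\mathrm{A}_\Gamma$ is the group of palindromic automorphisms: those $\alpha\in\mathrm{Aut}(A_\Gamma)$ such that for each $v\in V$ the element $\alpha(v)$ can be expressed as a word $u_1\cdots u_m$ on $V^{\pm1}$ identical, as a word, to its reverse $u_m\cdots u_1$. For a vertex $u$, $\mathrm{lk}(u)$ is the set of vertices adjacent to $u$ and $\mathrm{st}(u)=\mathrm{lk}(u)\cup\{u\}$; $u\le v$ means $\mathrm{lk}(u)\subset\mathrm{st}(v)$. Diagram automorphisms are those induced by graph automorphisms of $\Gamma$. The inversion $\iota_j$ maps $v_j\mapsto v_j^{-1}$ and fixes the other vertices. For $i\neq j$ with $v_i\le v_j$, the dominated elementary palindromic automorphism $P_{ij}$ maps $v_i\mapsto v_jv_iv_j$ and fixes the other vertices. *)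

(* Defs.v *)
From HB Require Import structures.
From mathcomp Require Import all_boot all_fingroup generic_quotient.
From mathcomp Require Import boolp classical_sets.

Set Implicit Arguments.
Unset Strict Implicit.
Unset Printing Implicit Defensive.

Local Open Scope group_scope.
Local Open Scope quotient_scope.
Local Open Scope classical_set_scope.

Record sgraph := SGraph {
  vertex :> finType;
  adj : rel vertex;
  adj_sym : symmetric adj;
  adj_irrefl : irreflexive adj
}.

Section Links.
Variable Gamma : sgraph.

Definition lk (u : Gamma) : {set Gamma} := [set w | adj u w]%SET.
Definition st (u : Gamma) : {set Gamma} := (u |: lk u)%SET.
Definition dominated_by (u v : Gamma) : bool := lk u \subset st v.

End Links.

(* A letter (v, false) stands for v and (v, true) for its inverse. *)
Notation letter Gamma := (vertex Gamma * bool)%type.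
Notation word Gamma := (seq (letter Gamma)).

(* The least congruence on words for which the quotient is the group
   presented by < V | [u, v] = 1 for u, v adjacent >. *)
Inductive raag_cong (Gamma : sgraph) : word Gamma -> word Gamma -> Prop :=
| raag_cong_refl w : raag_cong w w
| raag_cong_sym w1 w2 : raag_cong w1 w2 -> raag_cong w2 w1
| raag_cong_trans w1 w2 w3 :
    raag_cong w1 w2 -> raag_cong w2 w3 -> raag_cong w1 w3
| raag_cong_cat w1 w1' w2 w2' :
    raag_cong w1 w1' -> raag_cong w2 w2' -> raag_cong (w1 ++ w2) (w1' ++ w2')
| raag_cong_cancel (u : Gamma) (b : bool) :
    raag_cong [:: (u, b); (u, ~~ b)] [::]
| raag_cong_comm (u v : Gamma) : adj u v ->
    raag_cong [:: (u, false); (v, false); (u, true); (v, true)] [::].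

Section RAAG.
Variable Gamma : sgraph.

Definition raag_rel : rel (word Gamma) := fun w1 w2 => `[< raag_cong w1 w2 >].

Lemma raag_rel_refl : reflexive raag_rel.
Proof. by move=> w; apply/asboolP; exact: raag_cong_refl. Qed.

Lemma raag_rel_sym : symmetric raag_rel.
Proof. by move=> w1 w2; apply/asboolP/asboolP => /raag_cong_sym. Qed.

Lemma raag_rel_trans : transitive raag_rel.
Proof.
move=> w2 w1 w3 /asboolP h12 /asboolP h23.
by apply/asboolP; exact: raag_cong_trans h23.
Qed.

Canonical raag_equiv := EquivRel raag_rel
  raag_rel_refl raag_rel_sym raag_rel_trans.

Definition raag : Type := {eq_quot raag_rel}.
HB.instance Definition _ := Choice.on raag.
HB.instance Definition _ := EqQuotient.on raag.

Definition raag_class (w : word Gamma) : raag := \pi_raag w.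

Lemma raag_classP w1 w2 : raag_class w1 = raag_class w2 <-> raag_cong w1 w2.
Proof.
by split=> [/eqmodP /asboolP | h] //; apply/eqmodP; apply/asboolP.
Qed.

Definition inv_letter (a : letter Gamma) : letter Gamma := (a.1, ~~ a.2).
Definition inv_word (w : word Gamma) : word Gamma := rev (map inv_letter w).

Lemma inv_wordK : involutive inv_word.
Proof.
move=> w; rewrite /inv_word map_rev revK -map_comp -[RHS]map_id.
by apply: eq_map => -[u b] /=; rewrite /inv_letter /= negbK.
Qed.

Lemma inv_word_cat w1 w2 : inv_word (w1 ++ w2) = inv_word w2 ++ inv_word w1.
Proof. by rewrite /inv_word map_cat rev_cat. Qed.

Lemma raag_cong_mulV w : raag_cong (w ++ inv_word w) [::].
Proof.
elim: w => [|[u b] w IHw]; first exact: raag_cong_refl.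
rewrite -cat1s inv_word_cat /=.
apply: raag_cong_trans (raag_cong_cancel u b).
rewrite -cat1s -[X in raag_cong _ X]cat1s.
apply: raag_cong_cat; first exact: raag_cong_refl.
rewrite catA -[X in raag_cong _ X]cat0s.
by apply: raag_cong_cat => //; exact: raag_cong_refl.
Qed.

Lemma raag_cong_Vmul w : raag_cong (inv_word w ++ w) [::].
Proof. by have := raag_cong_mulV (inv_word w); rewrite inv_wordK. Qed.

Lemma raag_cong_inv w1 w2 :
  raag_cong w1 w2 -> raag_cong (inv_word w1) (inv_word w2).
Proof.
move=> h; apply: (@raag_cong_trans _ _ (inv_word w1 ++ (w2 ++ inv_word w2))).
  rewrite -[X in raag_cong X _]cats0.
  apply: raag_cong_cat; first exact: raag_cong_refl.
  exact/raag_cong_sym/raag_cong_mulV.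
rewrite catA -[X in raag_cong _ X]cat0s.
apply: raag_cong_cat; last exact: raag_cong_refl.
apply: raag_cong_trans (raag_cong_Vmul w1).
apply: raag_cong_cat; first exact: raag_cong_refl.
exact: raag_cong_sym.
Qed.

Definition raag_one : raag := raag_class [::].
Definition raag_mul (x y : raag) : raag := raag_class (repr x ++ repr y).
Definition raag_inv (x : raag) : raag := raag_class (inv_word (repr x)).

Lemma raag_repr w : raag_cong (repr (raag_class w)) w.
Proof. by apply/raag_classP; rewrite /raag_class reprK. Qed.

Lemma raag_classM w1 w2 :
  raag_mul (raag_class w1) (raag_class w2) = raag_class (w1 ++ w2).
Proof. by apply/raag_classP/raag_cong_cat; exact: raag_repr. Qed.

Lemma raag_classV w : raag_inv (raag_class w) = raag_class (inv_word w).
Proof. by apply/raag_classP/raag_cong_inv; exact: raag_repr. Qed.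

Lemma raag_ind (P : raag -> Prop) :
  (forall w, P (raag_class w)) -> forall x, P x.
Proof. by move=> h x; rewrite -[x]reprK; exact: h. Qed.

Lemma raag_mulA : associative raag_mul.
Proof.
elim/raag_ind=> w1; elim/raag_ind=> w2; elim/raag_ind=> w3.
by rewrite !raag_classM catA.
Qed.

Lemma raag_mul1 : left_id raag_one raag_mul.
Proof. by elim/raag_ind=> w; rewrite raag_classM. Qed.

Lemma raag_mulr1 : right_id raag_one raag_mul.
Proof. by elim/raag_ind=> w; rewrite raag_classM cats0. Qed.

Lemma raag_mulV : left_inverse raag_one raag_inv raag_mul.
Proof.
elim/raag_ind=> w; rewrite raag_classV raag_classM.
exact/raag_classP/raag_cong_Vmul.
Qed.

Lemma raag_mulrV : right_inverse raag_one raag_inv raag_mul.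
Proof.
elim/raag_ind=> w; rewrite raag_classV raag_classM.
exact/raag_classP/raag_cong_mulV.
Qed.

HB.instance Definition _ := isGroup.Build raag
  raag_mulA raag_mul1 raag_mulr1 raag_mulV raag_mulrV.

Definition raag_gen (v : Gamma) : raag := raag_class [:: (v, false)].

End RAAG.

Definition is_automorphism (G : groupType) (f : G -> G) : Prop :=
  {morph f : x y / x * y} /\ bijective f.

(* The boolean reflection only serves to make aut a subtype of G -> G. *)
Record aut (G : groupType) := Aut {
  aut_val :> G -> G;
  autP : `[< is_automorphism aut_val >]
}.

HB.instance Definition _ (G : groupType) := [isSub for @aut_val G].
HB.instance Definition _ (G : groupType) := [Choice of aut G by <:].

Section AutGroup.
Variable G : groupType.

Lemma aut_ext (a b : aut G) : a =1 b -> a = b.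
Proof. by move=> h; apply: val_inj; exact: funext. Qed.

Lemma aut_morph (a : aut G) : {morph a : x y / x * y}.
Proof. by case: a => f /= /asboolP[]. Qed.

Lemma aut_bij (a : aut G) : bijective a.
Proof. by case: a => f /= /asboolP[]. Qed.

Lemma aut_inverse (a : aut G) : {g : G -> G | cancel a g /\ cancel g a}.
Proof. by apply: cid; case: (aut_bij a) => g aK gK; exists g. Qed.

Lemma aut_one_subproof : `[< is_automorphism (@id G) >].
Proof. by apply/asboolP; split=> //; exists id. Qed.

Lemma aut_mul_subproof (a b : aut G) : `[< is_automorphism (a \o b) >].
Proof.
apply/asboolP; split=> [x y /=|]; first by rewrite !aut_morph.
exact: bij_comp (aut_bij a) (aut_bij b).
Qed.

Lemma aut_inv_subproof (a : aut G) :
  `[< is_automorphism (sval (aut_inverse a)) >].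
Proof.
case: (aut_inverse a) => g /= [aK gK]; apply/asboolP; split; last by exists a.
by move=> x y; apply: (can_inj aK); rewrite aut_morph !gK.
Qed.

Definition aut_one : aut G := Aut aut_one_subproof.
Definition aut_mul (a b : aut G) : aut G := Aut (aut_mul_subproof a b).
Definition aut_inv (a : aut G) : aut G := Aut (aut_inv_subproof a).

Lemma aut_mulA : associative aut_mul.
Proof. by move=> a b c; apply: aut_ext. Qed.

Lemma aut_mul1 : left_id aut_one aut_mul.
Proof. by move=> a; apply: aut_ext. Qed.

Lemma aut_mulr1 : right_id aut_one aut_mul.
Proof. by move=> a; apply: aut_ext. Qed.

Lemma aut_mulV : left_inverse aut_one aut_inv aut_mul.
Proof.
by move=> a; apply: aut_ext => x /=; case: (aut_inverse a) => g /= [aK _].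
Qed.

Lemma aut_mulrV : right_inverse aut_one aut_inv aut_mul.
Proof.
by move=> a; apply: aut_ext => x /=; case: (aut_inverse a) => g /= [_ gK].
Qed.

HB.instance Definition _ := isGroup.Build (aut G)
  aut_mulA aut_mul1 aut_mulr1 aut_mulV aut_mulrV.

End AutGroup.

Definition is_subgroup (G : groupType) (H : set G) : Prop :=
  [/\ H 1, forall x y, H x -> H y -> H (x * y) & forall x, H x -> H x^-1].

Definition generated_subgroup (G : groupType) (S : set G) : set G :=
  smallest (@is_subgroup G) S.

Section Palindromic.
Variable Gamma : sgraph.
Implicit Types alpha : aut (raag Gamma).

Definition palindrome (w : word Gamma) : Prop := rev w = w.

Definition PiA : set (aut (raag Gamma)) :=
  [set alpha | forall v : Gamma, exists w : word Gamma,
     palindrome w /\ alpha (raag_gen v) = raag_class w].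

Definition graph_automorphism (s : {perm Gamma}) : Prop :=
  forall u w : Gamma, adj (s u) (s w) = adj u w.

Definition diagram_automorphism : set (aut (raag Gamma)) :=
  [set alpha | exists2 s : {perm Gamma}, graph_automorphism s &
     forall u : Gamma, alpha (raag_gen u) = raag_gen (s u)].

(* An automorphism is determined by its values on the vertices, so the sets
   below contain exactly one automorphism per vertex, respectively per pair
   (u, v) with u != v and u dominated by v. *)
Definition inversion : set (aut (raag Gamma)) :=
  [set alpha | exists v : Gamma,
     alpha (raag_gen v) = (raag_gen v)^-1 /\
     forall u : Gamma, u != v -> alpha (raag_gen u) = raag_gen u].

Definition dominated_elementary_palindromic : set (aut (raag Gamma)) :=
  [set alpha | exists u v : Gamma,
     [/\ u != v, dominated_by u v,
         alpha (raag_gen u) = raag_gen v * raag_gen u * raag_gen v &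
         forall w : Gamma, w != u -> alpha (raag_gen w) = raag_gen w]].

(* With vertices indexed from 0, the vertices v_1, ..., v_k of the usual
   1-based indexing are the v i with i < k. *)
Definition fixes_first (n : nat) (v : 'I_n -> Gamma) (k : nat) :
    set (aut (raag Gamma)) :=
  [set alpha | forall i : 'I_n, (i < k)%N ->
     alpha (raag_gen (v i)) = raag_gen (v i)].

Definition PiA_stab (n : nat) (v : 'I_n -> Gamma) (k : nat) :
    set (aut (raag Gamma)) := PiA `&` fixes_first v k.

End Palindromic.

(* Main.v *)
Require Import Defs.
From mathcomp Require Import all_boot all_fingroup boolp classical_sets.
From mathcomp Require Import ssralg ssrnum ssrint zify.

(** Let A be the right-angled Artin group and rho its reversal anti-automorphism,
which fixes every vertex.  An automorphism alpha is palindromic exactly when it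
commutes with rho and acts on the abelianisation of A modulo 2 by a permutation
s of the vertices ([PiA_over], [over_PiA]): an element that is fixed by rho and
has the class of one vertex u modulo 2 peels from both ends down to
b u^(+-1) rho(b).  Both conditions pass to inverses, so the palindromic
automorphisms form a group.

The next ingredient concerns commuting elements.  If rho(g) = g then g is
cyclically reduced, and an element h commuting with g can be multiplied by an
even power of g so that nothing cancels against g any more; reading off two
non-adjacent letters x, y then gives two commuting words in a free monoid, so
that the numbers of x and y in the modified h are proportional to those in g
([proportional_in_coset]).  The even power does not change parities.  Parity
arguments on such proportions show that s is a graph automorphism
([over_graph_automorphism]) and, once s = 1, that every letter of alpha(u)
other than u dominates u ([support_dominates]).  When alpha fixes v_i, so does
s; hence composing alpha with the diagram automorphism of s^-1 reduces the
theorem to s = 1.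

Composing alpha on the right with the dominated elementary automorphism P_uv or
its inverse only changes alpha(u), into alpha(v)^e alpha(u) alpha(v)^e.  The
proof only uses such moves when alpha(u) differs from u, so the fixed vertices
are never touched: that is why the stabilisers are generated by the generators
that they contain.

Length alone is not a good measure of progress: on a complete graph the problem
is Euclid's algorithm in the level 2 congruence subgroup of GL_n(Z).  So the
vertices adjacent to all the other vertices that dominate them
([abelian_vertex]) come first.  Their images involve only commuting letters,
hence are described by an integer matrix with odd diagonal and even off-diagonal
entries; an odd and an even entry never have equal absolute values, and Euclid's
algorithm clears the matrix row by row ([row_step_in_H]).

After that a Nielsen argument on lengths applies.  If some letter of alpha(u) is
adjacent to u, its vertex is abelian and has an image of length one by now, so
that the letter can be removed ([shorten_by_adjacent]).  Otherwise cut each alpha(y), for y a letter, into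
halves, the first one ending with the central letter.  If the first half of
alpha(x) is a prefix of the first half of alpha(y) with x <> y, then alpha(y) can
be shortened by alpha(x).  If no first half is a prefix of another one, the
initial letters of Y can be read off alpha(Y) ([pre_alpha]); taking for Y the
preimage of a vertex shows that all images have length one, and alpha is a
product of inversions. *)

Set Implicit Arguments.
Unset Strict Implicit.
Unset Printing Implicit Defensive.
Local Open Scope group_scope.
Local Open Scope classical_set_scope.

(** * Reduced words up to commutation *)

Section Words.
Variable Gamma : sgraph.
Implicit Types (a b c : letter Gamma) (w z : word Gamma) (x y : Gamma).

Notation inv := (@inv_letter Gamma).

Lemma inv_letterK : involutive inv.
Proof. by case=> u e; rewrite /inv_letter /= negbK. Qed.

Lemma inv_letter_neq a : inv a != a.
Proof. by case: a => u [] /=; apply/negP => /eqP[]. Qed.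

(** A letter commutes past exactly the letters at adjacent vertices, so [a] can be
brought to the front of [w] when it comes before every other letter at a vertex
that is not adjacent to its own.  Equality of vertices counts as non-adjacency. *)
Definition initial a w : bool :=
  ohead [seq b <- w | ~~ adj a.1 b.1] == Some a.

(** The action of a letter on reduced words by left multiplication. *)
Definition push a w : word Gamma :=
  if initial (inv a) w then rem (inv a) w else a :: w.

Fixpoint reduced w : bool :=
  if w is a :: w' then ~~ initial (inv a) w' && reduced w' else true.

Definition pair_proj x y w : word Gamma := [seq b <- w | (b.1 == x) || (b.1 == y)].

(** Equality of traces: words agree up to commutations exactly when their
projections to all pairs of non-adjacent vertices agree.  This form makes
congruence properties immediate, and the projections themselves are what
[commuting_counts] needs. *)
Definition trace_eq w z : Prop := forall x y, ~~ adj x y -> pair_proj x y w = pair_proj x y z.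

Lemma trace_eq_sym w z : trace_eq w z -> trace_eq z w.
Proof. by move=> h x y /h. Qed.
Lemma trace_eq_trans w1 w2 w3 : trace_eq w1 w2 -> trace_eq w2 w3 -> trace_eq w1 w3.
Proof. by move=> h k x y hxy; rewrite h ?k. Qed.
Lemma trace_eq_cons a w z : trace_eq w z -> trace_eq (a :: w) (a :: z).
Proof. by move=> h x y /h /= ->. Qed.

Lemma trace_eq_swap a b w : adj a.1 b.1 -> trace_eq (a :: b :: w) (b :: a :: w).
Proof.
move=> ab x y xy /=; case: ifP => hx //; case: ifP => hy //.
exfalso; move: hx hy ab xy (adj_irrefl a.1) => /orP[] /eqP-> /orP[] /eqP->.
- by move=> ->.
- by move=> ->.
- by rewrite adj_sym => ->.
- by move=> ->.
Qed.

Lemma adjxx a : adj a.1 a.1 = false. Proof. exact: adj_irrefl. Qed.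

Lemma initial_cons a b w :
  initial a (b :: w) = if adj a.1 b.1 then initial a w else b == a.
Proof. by rewrite /initial /=; case: (adj _ _). Qed.

(** The projections determine the initial letters, so [initial] only depends on the trace. *)
Lemma initialP a w : reflect
  (forall y, ~~ adj a.1 y -> ohead (pair_proj a.1 y w) = Some a) (initial a w).
Proof.
apply: (iffP idP) => [|h].
  elim: w => // b w IHw; rewrite initial_cons.
  case: ifP => [ab /IHw h y ay|_ /eqP->] /=; last by rewrite eqxx.
  case: ifP => [/orP[] /eqP e|_]; last exact: h.
    by rewrite e adjxx in ab.
  by rewrite -e ab in ay.
elim: w h => [|b w IHw] h; first by have /= := h a.1; rewrite adjxx => /(_ isT).
rewrite initial_cons; case: ifP => [ab|ab].
  apply: IHw => y ay; have /= := h y ay; case: ifP => [/orP[] /eqP e|//].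
    by rewrite e adjxx in ab.
  by rewrite -e ab in ay.
by have /= := h b.1 (negbT ab); rewrite eqxx orbT => -[->].
Qed.

Lemma initial_trace_eq a w z : trace_eq w z -> initial a w = initial a z.
Proof. by move=> h; apply/initialP/initialP => k y ay; [rewrite -h|rewrite h] => //; apply: k. Qed.

Lemma filter_rem (P : pred (letter Gamma)) a w :
  [seq b <- rem a w | P b] =
  if P a then rem a [seq b <- w | P b] else [seq b <- w | P b].
Proof.
elim: w => /= [|b w IHw]; first by case: ifP.
case: eqP => [->|/eqP ba] /=; first by case: (P a) => //=; rewrite eqxx.
by rewrite IHw; case: (P b); case: (P a) => //=; rewrite (negPf ba).
Qed.

Lemma trace_eq_rem a w : initial a w -> trace_eq w (a :: rem a w).
Proof.
move=> /initialP h x y xy; rewrite /pair_proj /= filter_rem.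
case: (boolP ((a.1 == x) || (a.1 == y))) => [|//].
case/orP=> /eqP e; [have := h y|have := h x]; rewrite e ?xy.
  move=> /(_ isT); rewrite /pair_proj; case: filter => //= b w' [->].
  by rewrite eqxx.
rewrite adj_sym xy => /(_ isT).
rewrite /pair_proj (eq_filter (a2 := fun b => (b.1 == x) || (b.1 == y))); last first.
  by move=> b /=; rewrite orbC.
by case: filter => //= b w' [->]; rewrite eqxx.
Qed.

Lemma rem_trace_eq a w z : trace_eq w z -> trace_eq (rem a w) (rem a z).
Proof. by move=> h x y /h; rewrite /pair_proj !filter_rem => ->. Qed.

Lemma push_trace_eq a w z : trace_eq w z -> trace_eq (push a w) (push a z).
Proof.
by move=> h; rewrite /push (initial_trace_eq _ h); case: ifP => _; [apply: rem_trace_eq|apply: trace_eq_cons].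
Qed.

Lemma initial_rem_adj a b w : adj a.1 b.1 -> initial a (rem b w) = initial a w.
Proof. by rewrite /initial filter_rem => ->. Qed.

Lemma initial_rem_same a b w : initial a w -> a != b -> ~~ adj a.1 b.1 ->
  ~~ initial b w.
Proof.
move=> /initialP/(_ b.1) h ab nab; apply/negP => /initialP/(_ a.1).
rewrite adj_sym nab => /(_ isT); move: h; rewrite nab => /(_ isT).
rewrite /pair_proj (eq_filter (a2 := fun c => (c.1 == b.1) || (c.1 == a.1))); last first.
  by move=> c /=; rewrite orbC.
by move=> -> [e]; rewrite e eqxx in ab.
Qed.

(** Removing an initial letter from a reduced word cannot make its inverse
initial: otherwise the two would have been separated by letters adjacent to
both, and the word was not reduced. *)
Lemma reduced_rem a w : reduced w -> initial a w ->
  reduced (rem a w) /\ ~~ initial (inv a) (rem a w).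
Proof.
elim: w => [|b w IHw] //= /andP[nb rw]; rewrite initial_cons.
case: ifP => [ab iw|_ /eqP eb]; last by subst b; rewrite eqxx.
have [rw' ni] := IHw rw iw.
have ba : b == a = false by apply/eqP => e; rewrite e adjxx in ab.
rewrite ba /= initial_cons /= ab; split=> //.
by rewrite initial_rem_adj ?nb //= adj_sym.
Qed.

Lemma reduced_push a w : reduced w -> reduced (push a w).
Proof.
move=> rw; rewrite /push; case: ifP => [/(reduced_rem rw)[]|/= ->] //.
Qed.

Lemma pushK a w : reduced w -> trace_eq (push (inv a) (push a w)) w.
Proof.
move=> rw; rewrite {2}/push; case: ifP => [ia|nia].
  have [_ h] := reduced_rem rw ia.
  by rewrite /push (negPf h); apply/trace_eq_sym/trace_eq_rem.
by rewrite /push inv_letterK initial_cons adjxx eqxx /= eqxx.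
Qed.

Lemma rem_comm a b w : rem a (rem b w) = rem b (rem a w).
Proof.
elim: w => //= c w IHw; case: (c =P a) => [->|/eqP ca]; case: (_ =P b) => [->|/eqP cb] //=.
- by rewrite eqxx.
- by rewrite eqxx.
- by rewrite (negPf ca) (negPf cb) IHw.
Qed.

Lemma push_comm a b w : adj a.1 b.1 -> trace_eq (push a (push b w)) (push b (push a w)).
Proof.
move=> ab; have ba : adj b.1 a.1 by rewrite adj_sym.
have nab : (inv a == b) = false by apply/eqP => e; rewrite -e /= adjxx in ab.
have nba : (inv b == a) = false by apply/eqP => e; rewrite -e /= adjxx in ab.
rewrite /push; case: (boolP (initial (inv b) w)) => hb; case: (boolP (initial (inv a) w)) => ha.
- by rewrite !initial_rem_adj // ha hb rem_comm.
- by rewrite !initial_rem_adj // initial_cons ba (negPf ha) hb /= [a == _]eq_sym nba.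
- by rewrite !initial_rem_adj // initial_cons ab ha (negPf hb) /= [b == _]eq_sym nab.
- by rewrite !initial_cons ab ba (negPf ha) (negPf hb); apply: trace_eq_swap.
Qed.

Definition pushw w z : word Gamma := foldr push z w.

Lemma reduced_pushw w z : reduced z -> reduced (pushw w z).
Proof. by move=> rz; elim: w => //= a w; apply: reduced_push. Qed.

Lemma pushw_trace_eq w z1 z2 : trace_eq z1 z2 -> trace_eq (pushw w z1) (pushw w z2).
Proof. by move=> h; elim: w => //= a w; apply: push_trace_eq. Qed.

(** The defining relations act trivially on reduced traces, which is what makes
normal forms of group elements well defined up to [trace_eq]. *)
Lemma pushw_cong w1 w2 : raag_cong w1 w2 ->
  forall z, reduced z -> trace_eq (pushw w1 z) (pushw w2 z).
Proof.
elim=> {w1 w2}.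
- by [].
- by move=> w1 w2 _ IH z rz; apply/trace_eq_sym/IH.
- by move=> w1 w2 w3 _ IH1 _ IH2 z rz; apply: trace_eq_trans (IH1 z rz) (IH2 z rz).
- move=> w1 w1' w2 w2' _ IH1 _ IH2 z rz; rewrite /pushw !foldr_cat.
  apply: (trace_eq_trans (IH1 _ _)); first exact: reduced_pushw.
  by apply: pushw_trace_eq; apply: IH2.
- move=> u b z rz /=; have := pushK (u, ~~ b) rz.
  by rewrite /inv_letter /= negbK.
- move=> u v uv z rz /=.
  apply: (@trace_eq_trans _ (push (u, false) (push (u, true) (push (v, false) (push (v, true) z))))).
    by apply: push_trace_eq; apply: push_comm; rewrite /= adj_sym.
  apply: trace_eq_trans (pushK (v, true) rz).
  by apply: (pushK (u, true)); rewrite !reduced_push.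
Qed.

End Words.

(** * Length, initial letters and reversal of group elements *)

Section Elements.
Variable Gamma : sgraph.
Implicit Types (a b c : letter Gamma) (w z : word Gamma) (x y : Gamma).
Implicit Types (g h k : raag Gamma).

Notation inv := (@inv_letter Gamma).
Notation cls := (@raag_class Gamma).

Definition lett a : raag Gamma := raag_class [:: a].

Lemma class_cat w z : cls (w ++ z) = cls w * cls z.
Proof. by rewrite -raag_classM. Qed.

Lemma class_nil : cls [::] = 1. Proof. by []. Qed.

Lemma class_cons a w : cls (a :: w) = lett a * cls w.
Proof. by rewrite -class_cat. Qed.

Lemma lettV a : (lett a)^-1 = lett (inv a).
Proof. exact: raag_classV. Qed.

Lemma lett_gen (u : Gamma) : lett (u, false) = raag_gen u. Proof. by []. Qed.

Lemma lett_genV (u : Gamma) : lett (u, true) = (raag_gen u)^-1.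
Proof. by rewrite lettV. Qed.

Lemma lett_comm a b : adj a.1 b.1 -> commute (lett a) (lett b).
Proof.
have base (u v : Gamma) : adj u v -> commute (raag_gen u) (raag_gen v).
  move=> /raag_cong_comm/raag_classP; rewrite !class_cons class_nil mulg1.
  rewrite !lett_gen !lett_genV !mulgA => h.
  by apply/(mulIg (raag_gen u)^-1)/(mulIg (raag_gen v)^-1); rewrite h mulgK mulgV.
case: a b => u [] [] v [] /= /base h; rewrite ?lett_genV ?lett_gen //.
- by apply/commute_sym/commuteV/commute_sym/commuteV.
- by apply/commute_sym/commuteV/commute_sym.
- exact: commuteV.
Qed.

Lemma initial_class a w : initial a w -> cls w = lett a * cls (rem a w).
Proof.
elim: w => [|b w IHw] //; rewrite initial_cons class_cons.
case: ifP => [ab /IHw -> |_ /eqP->] /=; last by rewrite eqxx.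
have -> : b == a = false by apply/eqP => e; rewrite e adjxx in ab.
by rewrite class_cons !mulgA (lett_comm ab).
Qed.

Lemma push_class a w : cls (push a w) = lett a * cls w.
Proof.
rewrite /push; case: ifP => [/initial_class->|_]; last by rewrite class_cons.
by rewrite -lettV mulVKg.
Qed.

Lemma pushw_class w z : cls (pushw w z) = cls w * cls z.
Proof.
elim: w => [|a w IHw] /=; first by rewrite class_nil mul1g.
by rewrite push_class IHw class_cons mulgA.
Qed.

Lemma trace_eq_count x w z : trace_eq w z ->
  count (fun b => b.1 == x) w = count (fun b => b.1 == x) z.
Proof.
move=> /(_ x x); rewrite adj_irrefl => /(_ isT) h.
have e s : count (fun b : letter Gamma => b.1 == x) s = size (pair_proj x x s).
  by rewrite size_filter; apply: eq_count => b; rewrite orbb.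
by rewrite !e h.
Qed.

Lemma trace_eq_size w z : trace_eq w z -> size w = size z.
Proof.
move=> h; apply/perm_size/allP => a _ /=; apply/eqP.
have e s : count_mem a s = count_mem a (pair_proj a.1 a.1 s).
  by rewrite count_filter; apply: eq_count => b /=; case: eqP => // ->; rewrite eqxx.
by rewrite e [RHS]e h // adj_irrefl.
Qed.

Definition nf g : word Gamma := pushw (generic_quotient.repr g) [::].
Definition len g : nat := size (nf g).
Definition cnt x g : nat := count (fun b => b.1 == x) (nf g).
Definition pre a g : bool := initial a (nf g).

Arguments len g%_g.
Arguments cnt x g%_g.
Arguments pre a g%_g.

Lemma nf_reduced g : reduced (nf g). Proof. exact: reduced_pushw. Qed.

Lemma nfK g : cls (nf g) = g.
Proof. by rewrite pushw_class class_nil mulg1 /raag_class generic_quotient.reprK. Qed.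

Lemma nf_class w : trace_eq (nf (cls w)) (pushw w [::]).
Proof. by apply: pushw_cong => //; apply: raag_repr. Qed.

Lemma nf_reduced_class w : reduced w -> trace_eq (nf (cls w)) w.
Proof.
move=> rw; apply: (trace_eq_trans (nf_class w)).
elim: w rw => //= a w IHw /andP[na /IHw h].
apply: (trace_eq_trans (push_trace_eq a h)).
by rewrite /push (negPf na).
Qed.

Lemma nf_classM w h : trace_eq (nf (cls w * h)) (pushw w (nf h)).
Proof.
rewrite -{1}(nfK h) -class_cat; apply: (trace_eq_trans (nf_class _)).
rewrite /pushw foldr_cat; apply: pushw_trace_eq.
apply: (trace_eq_trans (trace_eq_sym (nf_class _))); exact: nf_reduced_class (nf_reduced h).
Qed.

Lemma nf_lettM a h : trace_eq (nf (lett a * h)) (push a (nf h)).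
Proof. exact: (nf_classM [:: a]). Qed.

Lemma pre_lettM_adj a b h : adj a.1 b.1 -> pre a (lett b * h) = pre a h.
Proof.
move=> ab; rewrite /pre (initial_trace_eq _ (nf_lettM b h)) /push.
by case: ifP => _; rewrite ?initial_cons ?ab // initial_rem_adj.
Qed.

Lemma pre_conflict a g : pre a g -> ~~ pre (inv a) g.
Proof.
move=> h; apply: initial_rem_same h _ _; last by rewrite adjxx.
by rewrite eq_sym inv_letter_neq.
Qed.

(** The local property from which the theory of prefixes is derived: two
different initial letters are adjacent. *)
Lemma pre_adj a b g : pre a g -> pre b g -> a != b -> adj a.1 b.1.
Proof.
move=> ha hb ab; apply: contraTT hb => nab.
exact: initial_rem_same ha ab nab.
Qed.

Lemma pre_self a h : ~~ pre (inv a) h -> pre a (lett a * h).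
Proof.
move=> na; rewrite /pre (initial_trace_eq _ (nf_lettM a h)) /push.
by rewrite -/(pre _ _) (negPf na) initial_cons adjxx eqxx.
Qed.

Lemma nf_lettM_reduced a h : ~~ pre (inv a) h -> trace_eq (nf (lett a * h)) (a :: nf h).
Proof. by move=> na; apply: (trace_eq_trans (nf_lettM a h)); rewrite /push -/(pre _ _) (negPf na). Qed.

Lemma pre_split a g : pre a g ->
  exists2 h, g = lett a * h & ~~ pre (inv a) h.
Proof.
move=> pa; exists (lett (inv a) * g); first by rewrite -lettV mulVKg.
rewrite /pre (initial_trace_eq _ (nf_lettM _ _)) /push inv_letterK.
rewrite (_ : initial a _ = true) //.
by have [_] := reduced_rem (nf_reduced g) pa.
Qed.

Lemma len1 : len 1 = 0%N.
Proof. by rewrite /len (trace_eq_size (nf_class [::])). Qed.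

Lemma pre1 a : pre a 1 = false.
Proof. by rewrite /pre (initial_trace_eq _ (nf_class [::])). Qed.

Lemma cnt1 x : cnt x 1 = 0%N.
Proof. by rewrite /cnt (trace_eq_count x (nf_class [::])). Qed.

Lemma len_lettM a h : ~~ pre (inv a) h -> len (lett a * h) = (len h).+1.
Proof. by move=> na; rewrite /len (trace_eq_size (nf_lettM_reduced na)). Qed.

Lemma cnt_lettM x a h : ~~ pre (inv a) h ->
  cnt x (lett a * h) = ((a.1 == x) + cnt x h)%N.
Proof. by move=> na; rewrite /cnt (trace_eq_count x (nf_lettM_reduced na)). Qed.

(** Induction on reduced words, phrased on group elements. *)
Lemma raag_pre_ind (P : raag Gamma -> Prop) : P 1 ->
  (forall a h, ~~ pre (inv a) h -> P h -> P (lett a * h)) -> forall g, P g.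
Proof.
move=> P1 PM g; rewrite -(nfK g); elim: (nf g) (nf_reduced g) => //= a w IHw.
case/andP=> na rw; rewrite class_cons; apply: PM; last exact: IHw.
by rewrite /pre (initial_trace_eq _ (nf_reduced_class rw)).
Qed.

Lemma len_eq0 g : len g = 0%N -> g = 1.
Proof. by rewrite -{2}(nfK g) => /size0nil->. Qed.

Lemma pre_exists g : g <> 1 -> exists a, pre a g.
Proof.
move=> g1; rewrite /pre; case E: (nf g) => [|a w].
  by case: g1; rewrite -(nfK g) E.
by exists a; rewrite initial_cons adjxx eqxx.
Qed.

Lemma len_preV a g : pre a g -> len g = (len (lett (inv a) * g)).+1.
Proof. by case/pre_split=> h -> na; rewrite -lettV mulKg len_lettM. Qed.

Lemma leq_len_lettM a h : (len (lett a * h) <= (len h).+1)%N.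
Proof.
case: (boolP (pre (inv a) h)) => [p|/len_lettM-> //].
by rewrite (len_preV p) inv_letterK ltnW // ltnW.
Qed.

Lemma preE a g : pre a g = (len (lett (inv a) * g) < len g)%N.
Proof.
apply/idP/idP => [/len_preV->|] //.
by apply: contraLR => na; rewrite -leqNgt len_lettM // inv_letterK.
Qed.

Lemma leq_cnt_lettM x a h : (cnt x (lett a * h) <= (a.1 == x) + cnt x h)%N.
Proof.
case: (boolP (pre (inv a) h)) => [/pre_split[k -> nk]|/cnt_lettM-> //].
by rewrite (cnt_lettM x nk) -lettV mulVKg addnA leq_addl.
Qed.

Lemma leq_len_class w : (len (cls w) <= size w)%N.
Proof.
elim: w => [|a w IHw]; first by rewrite class_nil len1.
by rewrite class_cons; apply: leq_trans (leq_len_lettM _ _) _.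
Qed.

Lemma leq_cnt_class x w : (cnt x (cls w) <= count (fun b => b.1 == x) w)%N.
Proof.
elim: w => [|a w IHw]; first by rewrite class_nil cnt1.
by rewrite class_cons; apply: leq_trans (leq_cnt_lettM _ _ _) _; rewrite leq_add2l.
Qed.

Lemma lenM g h : (len (g * h) <= len g + len h)%N.
Proof.
rewrite -{1}(nfK g) -{1}(nfK h) -class_cat.
by apply: leq_trans (leq_len_class _) _; rewrite size_cat.
Qed.

Lemma leq_cntM x g h : (cnt x (g * h) <= cnt x g + cnt x h)%N.
Proof.
rewrite -{1}(nfK g) -{1}(nfK h) -class_cat.
by apply: leq_trans (leq_cnt_class _ _) _; rewrite count_cat.
Qed.

Lemma lenV g : len g^-1 = len g.
Proof.
suff le h : (len h^-1 <= len h)%N by apply/eqP; rewrite eqn_leq le -{1}(invgK g) le.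
rewrite -{1}(nfK h); change ((cls (nf h))^-1) with (raag_inv (cls (nf h))).
rewrite raag_classV; apply: leq_trans (leq_len_class _) _.
by rewrite /inv_word size_rev size_map.
Qed.

Lemma cntV x g : cnt x g^-1 = cnt x g.
Proof.
suff le h : (cnt x h^-1 <= cnt x h)%N by apply/eqP; rewrite eqn_leq le -{1}(invgK g) le.
rewrite -{1}(nfK h); change ((cls (nf h))^-1) with (raag_inv (cls (nf h))).
rewrite raag_classV; apply: leq_trans (leq_cnt_class _ _) _.
by rewrite /inv_word count_rev count_map.
Qed.

Lemma raag_cong_rev w z : raag_cong w z -> cls (rev w) = cls (rev z).
Proof.
elim=> {w z}.
- by [].
- by move=> w1 w2 _ ->.
- by move=> w1 w2 w3 _ -> _ ->.
- by move=> w1 w1' w2 w2' _ h1 _ h2; rewrite !rev_cat !class_cat h1 h2.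
- move=> u b; rewrite (_ : rev _ = [:: (u, ~~ b); (u, b)]) //.
  by have /raag_classP := raag_cong_cancel u (~~ b); rewrite negbK.
- move=> u v uv; rewrite /rev /= !class_cons class_nil mulg1 !lett_genV.
  have h : commute (raag_gen u) (raag_gen v) by exact: (@lett_comm (u, false) (v, false)).
  rewrite !lett_gen !mulgA -invgM -[_ * _ * _]mulgA.
  by rewrite -h mulVg.
Qed.

Definition rho g : raag Gamma := cls (rev (generic_quotient.repr g)).

Lemma rho_class w : rho (cls w) = cls (rev w).
Proof. by apply: raag_cong_rev; apply: raag_repr. Qed.

Lemma rhoM g h : rho (g * h) = rho h * rho g.
Proof. by rewrite -(nfK g) -(nfK h) -class_cat !rho_class rev_cat class_cat. Qed.

Lemma rhoK : involutive rho.
Proof. by move=> g; rewrite -(nfK g) !rho_class revK. Qed.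

Lemma rho_lett a : rho (lett a) = lett a. Proof. exact: rho_class. Qed.

Lemma rho1 : rho 1 = 1. Proof. exact: (rho_class [::]). Qed.

Lemma rhoV g : rho g^-1 = (rho g)^-1.
Proof. by apply/esym/mulg1_eq; rewrite -rhoM mulVg rho1. Qed.

Lemma len_rho g : len (rho g) = len g.
Proof.
suff le h : (len (rho h) <= len h)%N by apply/eqP; rewrite eqn_leq le -{1}(rhoK g) le.
rewrite -{1}(nfK h) rho_class; apply: leq_trans (leq_len_class _) _.
by rewrite size_rev.
Qed.

Lemma cnt_rho x g : cnt x (rho g) = cnt x g.
Proof.
suff le h : (cnt x (rho h) <= cnt x h)%N by apply/eqP; rewrite eqn_leq le -{1}(rhoK g) le.
rewrite -{1}(nfK h) rho_class; apply: leq_trans (leq_cnt_class _ _) _.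
by rewrite count_rev.
Qed.

Lemma raag_cong_odd x w z : raag_cong w z ->
  odd (count (fun b => b.1 == x) w) = odd (count (fun b => b.1 == x) z).
Proof.
elim=> {w z} //=.
- by move=> w1 w2 w3 _ -> _ ->.
- by move=> w1 w1' w2 w2' _ h1 _ h2; rewrite !count_cat !oddD h1 h2.
- by move=> u b; case: (u == x).
- by move=> u v _; case: (u == x); case: (v == x).
Qed.

(** The class modulo 2 of [g] in the abelianisation, at the vertex [x]. *)
Definition par x g : bool := odd (cnt x g).

Lemma par_class x w : par x (cls w) = odd (count (fun b => b.1 == x) w).
Proof. by apply: raag_cong_odd; apply/raag_classP; rewrite nfK. Qed.

Lemma parM x g h : par x (g * h) = par x g (+) par x h.
Proof. by rewrite -(nfK g) -(nfK h) -class_cat !par_class count_cat oddD. Qed.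

Lemma par1 x : par x 1 = false. Proof. exact: (par_class x [::]). Qed.

Lemma parV x g : par x g^-1 = par x g. Proof. by rewrite /par cntV. Qed.

Lemma par_lett x a : par x (lett a) = (a.1 == x).
Proof. by rewrite par_class /= addn0 oddb. Qed.

Arguments par x g%_g.

Lemma leq_size_push a z : (size (push a z) <= (size z).+1)%N.
Proof.
rewrite /push; case: ifP => // _.
by apply: leq_trans (size_subseq (rem_subseq _ _)) _.
Qed.

Lemma size_push_cons a z : size (push a z) = (size z).+1 -> push a z = a :: z.
Proof.
rewrite /push; case: ifP => // _ h.
by have := size_subseq (rem_subseq (inv a) z); rewrite h ltnn.
Qed.

Lemma leq_size_pushw w z : (size (pushw w z) <= size w + size z)%N.
Proof. by elim: w => //= a w IH; apply: leq_trans (leq_size_push _ _) _. Qed.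

Lemma size_pushw_cat w z : size (pushw w z) = (size w + size z)%N ->
  pushw w z = w ++ z.
Proof.
elim: w => //= a w IHw h.
have le := leq_size_push a (pushw w z); have le' := leq_size_pushw w z.
have e : size (pushw w z) = (size w + size z)%N.
  by apply/eqP; rewrite eqn_leq le' -ltnS -addSn -h.
by rewrite -IHw //; apply: size_push_cons; rewrite h e.
Qed.

(** When lengths add up no push cancels, so the normal form of the product is the
concatenation. *)
Lemma nfM g h : len (g * h) = (len g + len h)%N ->
  trace_eq (nf (g * h)) (nf g ++ nf h).
Proof.
rewrite -{1 3}(nfK g) => e.
have t := nf_classM (nf g) h.
by apply: (trace_eq_trans t); rewrite size_pushw_cat // -(trace_eq_size t).
Qed.

Lemma cntM x g h : len (g * h) = (len g + len h)%N ->
  cnt x (g * h) = (cnt x g + cnt x h)%N.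
Proof. by move=> /nfM/(trace_eq_count x); rewrite count_cat. Qed.
End Elements.

Arguments len {Gamma} g%_g.
Arguments cnt {Gamma} x g%_g.
Arguments pre {Gamma} a g%_g.
Arguments par {Gamma} x g%_g.
Arguments rho {Gamma} g%_g.

(** * Cancellation and commuting elements *)

Section Prefixes.
Variable Gamma : sgraph.
Implicit Types (a b c : letter Gamma) (w z : word Gamma) (x y : Gamma).
Implicit Types (g h k p : raag Gamma).

Notation inv := (@inv_letter Gamma).

Definition adj_all a g : Prop := forall y, (0 < cnt y g)%N -> adj a.1 y.

Lemma adj_all1 a : adj_all a 1. Proof. by move=> y; rewrite cnt1. Qed.

Lemma adj_all_lettM a b h : ~~ pre (inv b) h ->
  adj_all a (lett b * h) <-> adj a.1 b.1 /\ adj_all a h.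
Proof.
move=> nb; split=> [ag|[ab ah] y]; last first.
  by rewrite cnt_lettM //; case: (b.1 =P y) => [<-|_] //=; apply: ah.
split; first by apply: ag; rewrite cnt_lettM // eqxx.
by move=> y hy; apply: ag; rewrite cnt_lettM // addn_gt0 hy orbT.
Qed.

Lemma pre_adj_allM a g h : adj_all a g -> pre a (g * h) = pre a h.
Proof.
elim/raag_pre_ind: g => [|b g nb IH]; first by rewrite mul1g.
by move=> /(adj_all_lettM a nb)[ab ag]; rewrite -mulgA pre_lettM_adj // IH.
Qed.

Lemma lett_comm_adj_all a g : adj_all a g -> commute (lett a) g.
Proof.
elim/raag_pre_ind: g => [_|b g nb IH]; first exact: commute1.
by move=> /(adj_all_lettM a nb)[ab ag]; apply: commuteM (lett_comm ab) (IH ag).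
Qed.

Lemma pre_mulr a g h : len (g * h) = (len g + len h)%N -> pre a g -> pre a (g * h).
Proof.
move=> e pa; rewrite preE e (len_preV pa) mulgA.
by apply: leq_ltn_trans (lenM _ _) _; rewrite ltn_add2r.
Qed.

(** In a reduced product, an initial letter comes from the first factor unless
it commutes with all of it. *)
Lemma pre_mul_cases a g h : len (g * h) = (len g + len h)%N ->
  pre a (g * h) -> pre a g \/ adj_all a g /\ pre a h.
Proof.
elim/raag_pre_ind: g => [|b g nb IH].
  by rewrite mul1g => _ pa; right; split=> //; apply: adj_all1.
rewrite -mulgA len_lettM // => e pa.
have e' : len (g * h) = (len g + len h)%N.
  apply/eqP; rewrite eqn_leq lenM /= -ltnS -addSn -e.
  exact: leq_len_lettM.
have nb' : ~~ pre (inv b) (g * h).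
  by apply/negP => /len_preV; rewrite inv_letterK e e'; lia.
case: (a =P b) => [->|/eqP ab]; first by left; apply: pre_self.
have abj := pre_adj pa (pre_self nb') ab.
rewrite pre_lettM_adj // in pa; case: (IH e' pa) => [pg|[ag ph]].
  by left; rewrite pre_lettM_adj.
by right; split=> //; apply/(adj_all_lettM a nb).
Qed.

(** If lengths do not add up, a last letter of the first factor is cancelled by
an initial letter of the second one.  The first factor is written [rho k] so that
the induction runs over its last letters. *)
Lemma len_rhoM_cases k h : len (rho k * h) = (len k + len h)%N \/
  exists2 a, pre a k & pre (inv a) h.
Proof.
elim/raag_pre_ind: k h => [|a k na IH] h; first by left; rewrite rho1 mul1g len1.
case: (boolP (pre (inv a) h)) => [pa|nah].
  by right; exists a => //; apply: pre_self.
rewrite rhoM rho_lett -mulgA len_lettM //.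
case: (IH (lett a * h)) => [->|[b pb pb']].
  by left; rewrite len_lettM // addSnnS.
have ba : inv b != a by apply: contraNneq na => <-; rewrite inv_letterK.
have abj : adj b.1 a.1 := pre_adj pb' (pre_self nah) ba.
by rewrite pre_lettM_adj // in pb'; right; exists b; rewrite ?pre_lettM_adj.
Qed.

Lemma lenM_cases g h : len (g * h) = (len g + len h)%N \/
  exists2 a, pre a (rho g) & pre (inv a) h.
Proof. by have := len_rhoM_cases (rho g) h; rewrite rhoK len_rho. Qed.

(** Elements fixed by reversal are cyclically reduced: a cancellation in [g * g]
would need a letter [a] that is both first and last in [g] while its inverse is
also first. *)
Lemma len_mulg_expg g n : rho g = g -> len (g * g ^+ n) = (len g + len (g ^+ n))%N.
Proof.
move=> rg; elim: n => [|n IH]; first by rewrite mulg1 len1 addn0.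
case: (lenM_cases g (g ^+ n.+1)) => [->//|[a]]; rewrite rg => pa.
by move/pre_conflict; rewrite inv_letterK expgS pre_mulr.
Qed.

Lemma len_expg g n : rho g = g -> len (g ^+ n) = (n * len g)%N.
Proof.
move=> rg; elim: n => [|n IH]; first by rewrite len1.
by rewrite expgS len_mulg_expg // IH mulSn.
Qed.

(** Multiplying by [g ^+ 2] adds at most [2 * len g] to the length and cannot
always add less, since the length of [g ^+ (2 * n) * h] is at least
[2 * n * len g - len h]. *)
Lemma absorb_power g h : rho g = g ->
  exists n, len (g * (g ^+ (2 * n) * h)) = (len g + len (g ^+ (2 * n) * h))%N.
Proof.
move=> rg.
have lb n : (2 * n * len g <= len (g ^+ (2 * n) * h) + len h)%N.
  rewrite -len_expg // -{1}(mulgK h (g ^+ _)) -(lenV h); exact: lenM.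
suff: forall m n, (len (g ^+ (2 * n) * h) + len h <= m + 2 * n * len g)%N ->
    exists n, len (g * (g ^+ (2 * n) * h)) = (len g + len (g ^+ (2 * n) * h))%N.
  by move=> /(_ (len h + len h)%N 0%N); apply; rewrite muln0 mul1g mul0n addn0.
elim=> [|m IH] n hn; have [e|ne] := eqVneq (len (g * (g ^+ (2 * n) * h)))
    (len g + len (g ^+ (2 * n) * h))%N; try (by exists n).
all: have lt1 : (len (g * (g ^+ (2 * n) * h)) < len g + len (g ^+ (2 * n) * h))%N
  by rewrite ltn_neqAle ne lenM.
all: have e3 : g * (g * (g ^+ (2 * n) * h)) = g ^+ (2 * n.+1) * h
  by rewrite mulnS !expgS !mulgA.
all: have := lenM g (g * (g ^+ (2 * n) * h)); rewrite e3 => lt2.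
all: have e4 : (2 * n.+1 * len g = len g + len g + 2 * n * len g)%N
  by rewrite mulnS mulnDl mul2n -addnn.
  by have := lb n.+1; rewrite e4; lia.
by apply: (IH n.+1); rewrite e4; lia.
Qed.

(** Two commuting words are powers of a common word, so letters occur in them
with the same frequency.  The induction is Euclid on the lengths. *)
Lemma count_commuting_seq (T : Type) (P : pred T) (u v : seq T) :
  u ++ v = v ++ u -> (size v * count P u = size u * count P v)%N.
Proof.
move: {2}(size u + size v)%N (leqnn (size u + size v)) => n.
elim: n u v => [|n IH] u v.
  by case: u v => [|? ?] [|? ?].
case: u v => [|a u] [|b v]; try by rewrite /= ?muln0 ?mul0n.
wlog: a b u v / (size u <= size v)%N => [W|huv] e h.
  case: (leqP (size u) (size v)) => huv; first exact: W.
  by apply/esym/W; rewrite // 1?addnC // ltnW.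
have hs : (size (a :: u) <= size (b :: v))%N by [].
have : take (size (a :: u)) ((b :: v) ++ (a :: u)) = a :: u.
  by rewrite -h take_size_cat.
rewrite takel_cat // => ht.
have : b :: v = (a :: u) ++ drop (size (a :: u)) (b :: v).
  by rewrite -[X in X ++ _]ht cat_take_drop.
move: (drop _ _) => v' ev; rewrite ev in h e *.
have h' : (a :: u) ++ v' = v' ++ (a :: u).
  by have := congr1 (drop (size (a :: u))) h; rewrite -catA !drop_size_cat.
have := IH (a :: u) v'; rewrite !count_cat !size_cat => IH'.
rewrite mulnDl mulnDr [in RHS]mulnC; rewrite IH' //; first by rewrite mulnC.
by move: e; rewrite !size_cat /=; lia.
Qed.

Lemma commuting_counts g p x y : commute g p ->
  len (g * p) = (len g + len p)%N -> ~~ adj x y ->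
  (cnt x p * cnt y g = cnt y p * cnt x g)%N.
Proof.
move=> com e xy; case: (x =P y) => [->//|/eqP nxy].
have e' : len (p * g) = (len p + len g)%N by rewrite -com e addnC.
have : pair_proj x y (nf g) ++ pair_proj x y (nf p) = pair_proj x y (nf p) ++ pair_proj x y (nf g).
  have projM w z : pair_proj x y w ++ pair_proj x y z = pair_proj x y (w ++ z).
    by rewrite /pair_proj filter_cat.
  by rewrite !projM -(nfM e xy) -(nfM e' xy) com.
move=> /(count_commuting_seq (fun b => b.1 == x)).
have cx h : count (fun b : letter Gamma => b.1 == x) (pair_proj x y (nf h)) = cnt x h.
  by rewrite count_filter; apply: eq_count => b /=; case: eqP.
have sz h : size (pair_proj x y (nf h)) = (cnt x h + cnt y h)%N.
  rewrite size_filter /cnt; elim: (nf h) => //= b w ->.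
  case: (b.1 =P x) => [->|_] /=; last by lia.
  by rewrite (negPf nxy); lia.
by rewrite !cx !sz; lia.
Qed.

(** Here [p] is the product of [h] with an even power of [g], which keeps the class
modulo 2.  All parity arguments use centralisers in this form. *)
Lemma proportional_in_coset g h : rho g = g -> commute g h ->
  exists p, (forall x, par x p = par x h) /\
    forall x y, ~~ adj x y -> (cnt x p * cnt y g = cnt y p * cnt x g)%N.
Proof.
move=> rg com; have [n e] := absorb_power h rg.
exists (g ^+ (2 * n) * h); split=> [x|x y xy].
  by rewrite parM mul2n -addnn expgnDr parM addbb.
apply: commuting_counts => //; apply: commuteM => //.
exact: commuteX.
Qed.
End Prefixes.

(** * Automorphisms given on the vertices *)

Section Homs.
Variable Gamma : sgraph.
Implicit Types (a b c : letter Gamma) (x y u v w z : Gamma).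
Implicit Types (g h k p : raag Gamma) (alpha beta : Defs.aut (raag Gamma)).

Lemma raag_gen_ind (P : raag Gamma -> Prop) : P 1 ->
  (forall u g, P g -> P (raag_gen u * g)) ->
  (forall u g, P g -> P ((raag_gen u)^-1 * g)) -> forall g, P g.
Proof.
move=> P1 PM PV; elim/raag_pre_ind => // -[u []] h _ Ph.
  by rewrite lett_genV; apply: PV.
exact: PM.
Qed.

Definition letter_image (f : Gamma -> raag Gamma) a : raag Gamma :=
  if a.2 then (f a.1)^-1 else f a.1.

Definition word_image (f : Gamma -> raag Gamma) (w : word Gamma) : raag Gamma :=
  foldr (fun a g => letter_image f a * g) 1 w.

Lemma word_image_cat f (w z : word Gamma) : word_image f (w ++ z) = word_image f w * word_image f z.
Proof. by elim: w => [|a w IH] /=; rewrite ?mul1g // IH mulgA. Qed.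

Lemma word_image_cong (f : Gamma -> raag Gamma) :
  (forall u v, adj u v -> commute (f u) (f v)) ->
  forall w z : word Gamma, raag_cong w z -> word_image f w = word_image f z.
Proof.
move=> fc w z; elim=> {w z} //.
- by move=> w1 w2 w3 _ -> _ ->.
- by move=> w1 w1' w2 w2' _ h1 _ h2; rewrite !word_image_cat h1 h2.
- by move=> u [] /=; rewrite /letter_image /= mulg1 ?mulVg ?mulgV.
- move=> u v uv; rewrite /= /letter_image /= mulg1 !mulgA.
  by rewrite (fc _ _ uv) mulgK mulgV.
Qed.

(** The universal property of the presentation. *)
Lemma raag_hom_exists (f : Gamma -> raag Gamma) :
  (forall u v, adj u v -> commute (f u) (f v)) ->
  exists F : raag Gamma -> raag Gamma,
    {morph F : g h / g * h} /\ forall u, F (raag_gen u) = f u.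
Proof.
move=> fc; exists (fun g => word_image f (nf g)).
have e (w : word Gamma) : word_image f (nf (raag_class w)) = word_image f w.
  by apply: word_image_cong => //; apply/raag_classP; rewrite nfK.
split=> [g h|u]; last by rewrite e /= /letter_image /= mulg1.
by rewrite -{1}(nfK g) -{1}(nfK h) -class_cat e word_image_cat.
Qed.

Lemma morph1 (F : raag Gamma -> raag Gamma) : {morph F : g h / g * h} -> F 1 = 1.
Proof. by move=> FM; apply: (mulgI (F 1)); rewrite -FM !mulg1. Qed.

Lemma morphV (F : raag Gamma -> raag Gamma) : {morph F : g h / g * h} ->
  {morph F : g / g^-1}.
Proof. by move=> FM g; apply/esym/mulg1_eq; rewrite -FM mulgV morph1. Qed.

Lemma morph_ext (F G : raag Gamma -> raag Gamma) :
  {morph F : g h / g * h} -> {morph G : g h / g * h} ->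
  (forall u, F (raag_gen u) = G (raag_gen u)) -> F =1 G.
Proof.
move=> FM GM e; elim/raag_gen_ind => [|u g IH|u g IH]; first by rewrite !morph1.
  by rewrite FM GM e IH.
by rewrite FM GM !morphV // e IH.
Qed.

Lemma aut_exists (f f' : Gamma -> raag Gamma) :
  (forall u v, adj u v -> commute (f u) (f v)) ->
  (forall u v, adj u v -> commute (f' u) (f' v)) ->
  (forall F, {morph F : g h / g * h} -> (forall u, F (raag_gen u) = f u) ->
     forall u, F (f' u) = raag_gen u) ->
  (forall F, {morph F : g h / g * h} -> (forall u, F (raag_gen u) = f' u) ->
     forall u, F (f u) = raag_gen u) ->
  exists alpha : Defs.aut (raag Gamma), forall u, alpha (raag_gen u) = f u.
Proof.
move=> fc fc' ff' f'f.
have [F [FM Fg]] := raag_hom_exists fc; have [F' [FM' Fg']] := raag_hom_exists fc'.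
have FF' : cancel F F'.
  apply: (@morph_ext (F' \o F) id) => [g h /=|//|u /=]; first by rewrite FM FM'.
  by rewrite Fg (f'f F').
have F'F : cancel F' F.
  apply: (@morph_ext (F \o F') id) => [g h /=|//|u /=]; first by rewrite FM' FM.
  by rewrite Fg' (ff' F).
have FP : `[< is_automorphism F >] by apply/asboolP; split=> //; exists F'.
by exists (Defs.Aut FP).
Qed.

Lemma aut_mulE alpha beta g : (alpha * beta) g = alpha (beta g). Proof. by []. Qed.

Lemma autK alpha g : alpha^-1 (alpha g) = g.
Proof. by rewrite -aut_mulE mulVg. Qed.

Lemma autVK alpha g : alpha (alpha^-1 g) = g.
Proof. by rewrite -aut_mulE mulgV. Qed.

Lemma aut1 alpha : alpha 1 = 1. Proof. exact: morph1 (aut_morph alpha). Qed.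

Lemma autV alpha g : alpha g^-1 = (alpha g)^-1.
Proof. exact: morphV (aut_morph alpha) g. Qed.

Lemma aut_gen_ext alpha beta :
  (forall u, alpha (raag_gen u) = beta (raag_gen u)) -> alpha = beta.
Proof. by move=> h; apply: aut_ext; apply: morph_ext; [exact: aut_morph..|]. Qed.

Lemma aut_commute alpha g h : commute g h -> commute (alpha g) (alpha h).
Proof. by move=> c; rewrite /commute -!aut_morph c. Qed.

Lemma gen_comm u v : adj u v -> commute (raag_gen u) (raag_gen v).
Proof. exact: (@lett_comm _ (u, false) (v, false)). Qed.

Lemma diagram_exists (s : {perm Gamma}) : graph_automorphism s ->
  exists alpha : Defs.aut (raag Gamma), forall u, alpha (raag_gen u) = raag_gen (s u).
Proof.
move=> gs; apply: (@aut_exists _ (fun u => raag_gen (s^-1%g u))).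
- by move=> u v uv; apply: gen_comm; rewrite gs.
- by move=> u v uv; apply: gen_comm; rewrite -gs !permKV.
- by move=> F _ Fg u; rewrite Fg permKV.
- by move=> F _ Fg u; rewrite Fg permK.
Qed.

Lemma inversion_exists v : exists alpha : Defs.aut (raag Gamma),
  alpha (raag_gen v) = (raag_gen v)^-1 /\
  forall u, u != v -> alpha (raag_gen u) = raag_gen u.
Proof.
pose f u : raag Gamma := if u == v then (raag_gen u)^-1 else raag_gen u.
have fc u w : adj u w -> commute (f u) (f w).
  move=> /gen_comm h; rewrite /f; case: ifP => _; case: ifP => _ //.
  - by apply/commute_sym/commuteV/commute_sym/commuteV.
  - by apply/commute_sym/commuteV/commute_sym.
  - exact: commuteV.
have ff F : {morph F : g h / g * h} -> (forall u, F (raag_gen u) = f u) ->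
    forall u, F (f u) = raag_gen u.
  move=> FM Fg u; rewrite /f; case: ifP => e; last by rewrite Fg /f e.
  by rewrite morphV // Fg /f e invgK.
have [alpha ha] := aut_exists fc fc ff ff.
by exists alpha; split=> [|u /negPf e]; rewrite ha /f ?eqxx ?e.
Qed.

(** Domination is what makes the new image of [u] commute with the neighbours of
[u].  The sign [e] provides the inverse at the same time. *)
Lemma transvection_exists u v (e : bool) : u != v -> dominated_by u v ->
  exists alpha : Defs.aut (raag Gamma),
    alpha (raag_gen u) = lett (v, e) * raag_gen u * lett (v, e) /\
    forall w, w != u -> alpha (raag_gen w) = raag_gen w.
Proof.
move=> uv duv; have vu : (v == u) = false by rewrite eq_sym (negPf uv).
pose f e w : raag Gamma :=
  if w == u then lett (v, e) * raag_gen u * lett (v, e) else raag_gen w.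
have comm d w : adj u w -> commute (raag_gen w) (lett (v, d) * raag_gen u * lett (v, d)).
  move=> uw; have : w \in st v by apply: (fintype.subsetP duv); rewrite inE.
  rewrite !inE => wv.
  have cw : commute (raag_gen w) (lett (v, d)).
    case/orP: wv => [/eqP->|vw].
      by case: d; rewrite ?lett_genV; [apply: commuteV|]; apply: commute_refl.
    by apply: (@lett_comm _ (w, false) (v, d)); rewrite /= adj_sym.
  apply: commuteM => //; apply: commuteM => //.
  by apply: gen_comm; rewrite adj_sym.
have fc d w z : adj w z -> commute (f d w) (f d z).
  move=> wz; rewrite /f; case: (w =P u) => [ewu|_]; case: (z =P u) => [ezu|_].
  - exact: commute_refl.
  - by apply/commute_sym/comm; rewrite -ewu.
  - by apply: comm; rewrite -ezu adj_sym.
  - exact: gen_comm.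
have ff d F : {morph F : g h / g * h} -> (forall w, F (raag_gen w) = f d w) ->
    forall w, F (f (~~ d) w) = raag_gen w.
  move=> FM Fg w; rewrite /f; case: (w =P u) => [->|/eqP wu]; last first.
    by rewrite Fg /f (negPf wu).
  have Fv : F (lett (v, ~~ d)) = (lett (v, d))^-1.
    by case: d Fg => Fg; rewrite lettV /inv_letter /= ?lett_genV ?lett_gen ?morphV // Fg /f vu.
  by rewrite !FM Fv Fg /f eqxx !mulgA mulVg mul1g mulgK.
have ff' F : {morph F : g h / g * h} -> (forall w, F (raag_gen w) = f (~~ e) w) ->
    forall w, F (f e w) = raag_gen w.
  by move=> FM Fg w; rewrite -{1}(negbK e); apply: ff.
have [alpha ha] := aut_exists (fc e) (fc (~~ e)) (ff e) ff'.
by exists alpha; split=> [|w /negPf ew]; rewrite ha /f ?eqxx ?ew.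
Qed.
End Homs.

(** * The group of palindromic automorphisms *)

Section PalindromicStructure.
Variable Gamma : sgraph.
Implicit Types (a : letter Gamma) (x y u v : Gamma).
Implicit Types (g h k p : raag Gamma) (alpha beta : Defs.aut (raag Gamma)).
Implicit Types (s t : {perm Gamma}).

Notation inv := (@inv_letter Gamma).

Lemma len_lett a : len (lett a) = 1%N.
Proof. by rewrite -[lett a]mulg1 len_lettM ?pre1 ?len1. Qed.

(** Either the first and the last occurrence of [a] are different letters, and both
can be peeled off, or they are the same one, and [a] commutes with the rest. *)
Lemma rho_fixed_split a g : rho g = g -> pre a g ->
  (exists2 k, rho k = k & g = lett a * k * lett a /\ len g = (len k).+2) \/
  exists2 h, adj_all a h & [/\ rho h = h, g = lett a * h & len g = (len h).+1].
Proof.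
move=> rg pa; have [h eg nh] := pre_split pa.
have lg : len g = (len h).+1 by rewrite eg len_lettM.
have e : rho h * lett a = lett a * h by rewrite -{1}(rho_lett a) -rhoM -eg rg.
case: (boolP (pre a (rho h))) => [/pre_split[k ek nk]|np].
  have eh : h = rho k * lett a by rewrite -(rhoK h) ek rhoM rho_lett.
  left; exists k; last first.
    by split; [rewrite eg -e ek | rewrite lg -(len_rho h) ek len_lettM].
  by apply: (mulIg (lett a)); rewrite -eh; apply: (mulgI (lett a)); rewrite -e ek mulgA.
right; have ah : adj_all a h.
  have lr : len (rho h * lett a) = (len (rho h) + len (lett a))%N.
    by rewrite e -eg lg len_rho len_lett addn1.
  case: (pre_mul_cases (a := a) lr); first by rewrite e -eg.
    by rewrite (negPf np).
  by case=> ar _ y hy; apply: ar; rewrite cnt_rho.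
exists h => //; split=> //; apply: (mulIg (lett a)).
by rewrite e (lett_comm_adj_all ah).
Qed.

(** Peeling letters from both ends leaves pairwise commuting letters at distinct
vertices.  Each of these is odd modulo 2, so the class modulo 2 tells that there
is none in the first case and one in the second. *)
Lemma rho_fixed_decomp g : rho g = g ->
  ((forall x, par x g = false) ->
     exists2 b, g = b * rho b & len g = (2 * len b)%N) /\
  (forall u, (forall x, par x g = (u == x)) ->
     exists b (e : bool), g = b * lett (u, e) * rho b /\ len g = (2 * len b).+1).
Proof.
have [n] := ubnP (len g); elim: n g => // n IH g lt rg.
case: (EM (g = 1)) => [->|/pre_exists[a pa]].
  split=> [_|u /(_ u)]; first by exists 1; rewrite ?rho1 ?mulg1 ?len1.
  by rewrite par1 eqxx.
case: (rho_fixed_split rg pa) => [[k rk [eg lg]]|[h ah [rh eg lg]]].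
  have ltk : (len k < n)%N by lia.
  have pk x : par x k = par x g.
    by rewrite eg !parM par_lett; case: (_ == _); case: (par x k).
  have [IH0 IH1] := IH k ltk rk.
  have lenb b : (len k <= 2 * len b + 1 -> (len (lett a * b) <= (len b).+1))%N.
    by move=> _; apply: leq_len_lettM.
  split=> [p0|u pu].
    have [b eb lb] := IH0 (fun x => etrans (pk x) (p0 x)).
    have eg' : g = (lett a * b) * rho (lett a * b).
      by rewrite rhoM rho_lett eg eb !mulgA.
    exists (lett a * b) => //; have := leq_len_lettM a b.
    by have := lenM (lett a * b) (rho (lett a * b)); rewrite len_rho -eg'; lia.
  have [b [e [eb lb]]] := IH1 u (fun x => etrans (pk x) (pu x)).
  have eg' : g = (lett a * b) * lett (u, e) * rho (lett a * b).
    by rewrite rhoM rho_lett eg eb !mulgA.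
  exists (lett a * b), e; split=> //; have := leq_len_lettM a b.
  have := lenM (lett a * b * lett (u, e)) (rho (lett a * b)).
  have := lenM (lett a * b) (lett (u, e)).
  by rewrite len_lett len_rho -eg'; lia.
have c0 : cnt a.1 h = 0%N.
  by case E: (cnt a.1 h) => [//|m]; have := ah a.1; rewrite E adj_irrefl => /(_ isT).
have pa1 : par a.1 g by rewrite eg parM par_lett eqxx /par c0.
split=> [/(_ a.1)|u pu]; first by rewrite pa1.
have eu : u = a.1 by apply/eqP; rewrite -pu.
have [IH0 _] := IH h ltac:(lia) rh.
have [|c ec lc] := IH0.
  move=> x; have := pu x; rewrite eg parM par_lett eu; case: (_ == _) => //=.
  by case: (par x h).
have ac : adj_all a c.
  move=> y hy; apply: ah; rewrite ec cntM ?addn_gt0 ?hy //.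
  by rewrite -ec len_rho lc; lia.
exists c, a.2; split; last by lia.
by rewrite eu -surjective_pairing -(lett_comm_adj_all ac) eg ec mulgA.
Qed.

Lemma palindrome_parity (w : word Gamma) : palindrome w ->
  (forall x, odd (count (fun b => b.1 == x) w) = false) \/
  exists y, forall x, odd (count (fun b => b.1 == x) w) = (y == x).
Proof.
rewrite /palindrome; have [n] := ubnP (size w); elim: n w => // n IH [|a w] lt.
  by left.
case/lastP: w lt => [|w b] lt; first by right; exists a.1 => x /=; rewrite addn0 oddb.
rewrite rev_cons rev_rcons rcons_cons => -[eba /rcons_inj[rw _]].
have cw x : odd (count (fun b => b.1 == x) (a :: rcons w b)) =
            odd (count (fun b => b.1 == x) w).
  by rewrite /= -cats1 count_cat eba /= addn0 addnCA addnn oddD odd_double addbF.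
have ltw : (size w < n)%N by move: lt; rewrite /= size_rcons; lia.
case: (IH w ltw rw) => [h|[y h]]; first by left=> x; rewrite cw.
by right; exists y => x; rewrite cw.
Qed.

Lemma decomp_palindrome (a : letter Gamma) :
  forall k, exists w : word Gamma, palindrome w /\ k * lett a * rho k = raag_class w.
Proof.
move=> k; exists (nf k ++ a :: rev (nf k)); split.
  by rewrite /palindrome rev_cat rev_cons revK cat_rcons.
by rewrite class_cat class_cons nfK -rho_class nfK mulgA.
Qed.

(** The algebraic characterisation of palindromic automorphisms.  It only mentions
reversal and classes modulo 2, and so is visibly stable under inverses. *)
Definition palindromic_over s alpha : Prop :=
  (forall g, rho (alpha g) = alpha (rho g)) /\
  forall x g, par (s x) (alpha g) = par x g.

Lemma palindromic_over_gens s alpha :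
  (forall u, rho (alpha (raag_gen u)) = alpha (raag_gen u)) ->
  (forall u x, par x (alpha (raag_gen u)) = (s u == x)) -> palindromic_over s alpha.
Proof.
move=> hr hp; split=> [|x].
  elim/raag_gen_ind => [|u g IH|u g IH]; first by rewrite aut1 !rho1 aut1.
    by rewrite aut_morph !rhoM aut_morph IH hr (rho_lett (u, false)).
  by rewrite aut_morph !rhoM aut_morph IH autV !rhoV autV hr (rho_lett (u, false)).
elim/raag_gen_ind => [|u g IH|u g IH]; first by rewrite aut1 !par1.
  by rewrite aut_morph !parM IH hp (inj_eq perm_inj) (par_lett x (u, false)).
by rewrite aut_morph !parM IH autV !parV hp (inj_eq perm_inj) (par_lett x (u, false)).
Qed.

Lemma palindromic_over_gen s alpha u : palindromic_over s alpha ->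
  rho (alpha (raag_gen u)) = alpha (raag_gen u) /\
  forall x, par x (alpha (raag_gen u)) = (s u == x).
Proof.
case=> hr hp; split=> [|x]; first by rewrite hr (rho_lett (u, false)).
by rewrite -(permKV s x) hp (inj_eq perm_inj) (par_lett _ (u, false)).
Qed.

Lemma palindromic_overM s t alpha beta :
  palindromic_over s alpha -> palindromic_over t beta ->
  palindromic_over (t * s)%g (alpha * beta).
Proof.
move=> [ar ap] [br bp]; split=> [g|x g]; first by rewrite !aut_mulE ar br.
by rewrite permM aut_mulE ap bp.
Qed.

Lemma palindromic_overV s alpha :
  palindromic_over s alpha -> palindromic_over s^-1%g alpha^-1.
Proof.
move=> [ar ap]; split=> [g|x g].
  by rewrite -[LHS](autK alpha) -ar autVK.
by rewrite -ap permKV autVK.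
Qed.

(** A palindrome has at most one vertex of odd multiplicity.  By surjectivity
every vertex is the odd one of some image, and counting gives a permutation. *)
Lemma PiA_over alpha : PiA alpha -> exists s, palindromic_over s alpha.
Proof.
move=> pal.
have /choice[c hc] : forall u, exists o : option Gamma,
    forall x, par x (alpha (raag_gen u)) = (o == Some x).
  move=> u; have [w [pw ->]] := pal u.
  case: (palindrome_parity pw) => [h|[y h]]; [exists None|exists (Some y)] => x.
    by rewrite par_class h.
  by rewrite par_class h.
have /choice[t ht] : forall x, exists u, c u = Some x.
  move=> x; apply: contrapT => /forallNP nx.
  have h g : par x (alpha g) = false.
    have hu u : par x (alpha (raag_gen u)) = false by rewrite hc; apply/eqP/nx.
    elim/raag_gen_ind: g => [|u g IH|u g IH]; first by rewrite aut1 par1.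
      by rewrite aut_morph parM IH hu.
    by rewrite aut_morph parM IH autV parV hu.
  by have := h (alpha^-1 (raag_gen x)); rewrite autVK (par_lett x (x, false)) eqxx.
have ti : injective t by move=> x y e; have := ht x; rewrite e ht => -[].
(* t sends the odd vertex of an image back to the vertex that it comes from *)
exists (perm ti)^-1%g; apply: palindromic_over_gens => [u|u x].
  by have [w [pw ->]] := pal u; rewrite rho_class pw.
rewrite hc -{1}(permKV (perm ti) u) permE ht; exact: inj_eq Some_inj _ _.
Qed.

Lemma over_PiA s alpha : palindromic_over s alpha -> PiA alpha.
Proof.
move=> pa u; have [ru pu] := palindromic_over_gen u pa.
have [_ /(_ _ pu)[b [e [-> _]]]] := rho_fixed_decomp ru.
exact: (decomp_palindrome (s u, e) b).
Qed.

Lemma PiA_subgroup : is_subgroup (@PiA Gamma).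
Proof.
split=> [|alpha beta /PiA_over[s hs] /PiA_over[t ht]|alpha /PiA_over[s hs]].
- apply: (@over_PiA 1%g); apply: palindromic_over_gens => u; first exact: (rho_lett (u, false)).
  by move=> x; rewrite perm1; exact: (par_lett x (u, false)).
- exact: over_PiA (palindromic_overM hs ht).
- exact: over_PiA (palindromic_overV hs).
Qed.

(** If [s u] and [s w] were not adjacent, the numbers of these letters in [alpha u]
and in an element with the parities of [alpha w] would be proportional, but one
cross product is odd and the other one even.  An injective map preserving edges of
a finite graph also reflects them. *)
Lemma over_graph_automorphism s alpha :
  palindromic_over s alpha -> graph_automorphism s.
Proof.
move=> pa.
have step u w : adj u w -> adj (s u) (s w).
  move=> uw; apply/negPn/negP => nadj.
  have [rg pg] := palindromic_over_gen u pa; have [_ ph] := palindromic_over_gen w pa.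
  have [q [pq cq]] := proportional_in_coset rg (aut_commute alpha (gen_comm uw)).
  have nuw : (s w == s u) = false.
    by rewrite (inj_eq perm_inj); apply/eqP => e; rewrite e adj_irrefl in uw.
  have := congr1 odd (cq _ _ nadj); rewrite !oddM -!/(par _ _) !pq !ph !pg.
  by rewrite nuw !eqxx.
(* adjacency is reflected because the inverse of s is a power of s *)
have steps n u w : adj u w -> adj ((s ^+ n)%g u) ((s ^+ n)%g w).
  elim: n => [|n IH] uw; first by rewrite !perm1.
  by rewrite !expgSr !permM; apply/step/IH.
move=> u w; apply/idP/idP => [h|]; last exact: step.
have := steps #[s]%g.-1 _ _ h; rewrite -invg_expg -!permM.
by rewrite mulgV !perm1.
Qed.

(** Suppose [w] is adjacent to [u], but different from [v] and not adjacent to it.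
The images of [u] and [w] commute, which gives a proportion at the pair [(v, w)].
If [v] is adjacent to [u] too, the image of [v] gives a second proportion at the
same pair; if not, the image of [w] gives one at the pair [(u, v)].  Eliminating the
number of [v], which is positive, leaves an equality between an odd and an even
number. *)
Lemma support_dominates alpha u v : palindromic_over 1%g alpha ->
  v != u -> (0 < cnt v (alpha (raag_gen u)))%N -> dominated_by u v.
Proof.
move=> pa vu cv; apply/fintype.subsetP => w; rewrite !inE => uw.
apply/norP => -[wv nvw].
have com z : adj u z -> commute (alpha (raag_gen u)) (alpha (raag_gen z)).
  by move=> uz; apply/aut_commute/gen_comm.
have [ru pu] := palindromic_over_gen u pa.
have [q [pq cq]] := proportional_in_coset ru (com _ uw).
have [_ pw] := palindromic_over_gen w pa.
have wu : (w == u) = false by apply/eqP => e; rewrite e adj_irrefl in uw.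
have pqE x : odd (cnt x q) = (w == x) by rewrite -/(par x q) pq pw perm1.
have puE x : odd (cnt x (alpha (raag_gen u))) = (u == x) by rewrite -/(par _ _) pu perm1.
have cvw := cq _ _ nvw.
move: cv pqE puE cvw cq; set g := alpha (raag_gen u) => cv pqE puE cvw cq.
case: (boolP (adj u v)) => [uv|nuv].
  have [r [pr cr]] := proportional_in_coset ru (com _ uv).
  have [_ pv] := palindromic_over_gen v pa.
  have prE x : odd (cnt x r) = (v == x) by rewrite -/(par x r) pr pv perm1.
  have := cr _ _ nvw; rewrite -/g => crvw.
  have e : (cnt v r * cnt w q)%N = (cnt w r * cnt v q)%N.
    apply/eqP; rewrite -(eqn_pmul2r cv); apply/eqP.
    rewrite -mulnA -cvw mulnCA crvw mulnCA; lia.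
  have := congr1 odd e; rewrite !oddM !pqE !prE !eqxx [v == w]eq_sym (negPf wv).
  by [].
have cuv := cq _ _ nuv.
have e : (cnt u q * cnt w g)%N = (cnt w q * cnt u g)%N.
  apply/eqP; rewrite -(eqn_pmul2r cv); apply/eqP.
  rewrite mulnAC cuv mulnAC -[RHS]mulnAC -cvw; lia.
have := congr1 odd e; rewrite !oddM !pqE !puE !eqxx wu eq_sym wu.
by [].
Qed.
End PalindromicStructure.

(** * The prefix order *)

Section PrefixOrder.
Variable Gamma : sgraph.
Implicit Types (a b e : letter Gamma) (x y u v : Gamma).
Implicit Types (g h k c d G : raag Gamma).

Notation inv := (@inv_letter Gamma).

Definition prefix c g : bool := len c + len (c^-1 * g) == len g.

Lemma prefixE c g : prefix c g = (len c + len (c^-1 * g) <= len g)%N.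
Proof.
apply/eqP/idP => [->//|le]; apply/eqP; rewrite eqn_leq le /=.
by rewrite -{1}(mulVKg c g) lenM.
Qed.

Lemma prefix_len c g : prefix c g -> len g = (len c + len (c^-1 * g))%N.
Proof. by move/eqP. Qed.

Lemma prefix1 g : prefix 1 g.
Proof. by rewrite /prefix len1 invg1 mul1g. Qed.

Lemma prefix_of1 c : prefix c 1 -> c = 1.
Proof. by rewrite /prefix len1 addn_eq0 => /andP[/eqP/len_eq0]. Qed.

Lemma prefix_trans c d g : prefix c d -> prefix d g -> prefix c g.
Proof.
rewrite (prefixE c g) => /eqP cd /eqP dg.
by have := lenM (c^-1 * d) (d^-1 * g); rewrite -mulgA mulVKg -dg -cd -addnA leq_add2l.
Qed.

Lemma prefix_mulr g h : len (g * h) = (len g + len h)%N -> prefix g (g * h).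
Proof. by move=> e; rewrite /prefix mulKg e. Qed.

Lemma prefix_lett a g : prefix (lett a) g = pre a g.
Proof.
rewrite /prefix len_lett lettV; apply/eqP/idP => [e|/len_preV->//].
by rewrite preE -e add1n.
Qed.

Lemma prefix_cnt x c g : prefix c g -> (cnt x c <= cnt x g)%N.
Proof.
move=> /prefix_len e; rewrite -(mulVKg c g) cntM ?leq_addr //.
by rewrite mulVKg.
Qed.

Lemma pre_cnt a g : pre a g -> (0 < cnt a.1 g)%N.
Proof. by case/pre_split=> h -> na; rewrite cnt_lettM // eqxx. Qed.

Lemma pre_prefix a c g : pre a c -> prefix c g -> pre a g.
Proof. by rewrite -!prefix_lett; apply: prefix_trans. Qed.

Lemma prefix_lettM a c g : ~~ pre (inv a) c -> ~~ pre (inv a) g ->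
  prefix (lett a * c) (lett a * g) = prefix c g.
Proof.
move=> nc ng; rewrite /prefix !len_lettM // invgM -mulgA mulKg.
by rewrite addSn eqSS.
Qed.

Lemma prefix_disjoint_lett a d G : pre a G -> prefix d G -> ~~ pre a d ->
  adj_all a d /\ prefix d (lett (inv a) * G).
Proof.
elim/raag_pre_ind: d G => [|b d nb IH] G pa pd npa.
  by split; [apply: adj_all1|apply: prefix1].
have pb : pre b G := pre_prefix (pre_self nb) pd.
have ab : adj a.1 b.1.
  by apply: pre_adj pa pb _; apply: contraNneq npa => ->; apply: pre_self.
have [G' eG nG'] := pre_split pb.
move: pa pd npa; rewrite eG !pre_lettM_adj // prefix_lettM // => pa pd npa.
have [ad pd'] := IH _ pa pd npa; split; first by apply/(adj_all_lettM a nb).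
have ab' : adj (inv a).1 b.1 by [].
rewrite mulgA (lett_comm ab') -mulgA prefix_lettM //.
by rewrite pre_lettM_adj //= adj_sym.
Qed.

(** An initial letter of [c] is initial in [G] but not in [d], so all of [d] commutes
with it and remains a prefix once it is removed. *)
Lemma prefix_disjoint c d G : prefix c G -> prefix d G ->
  (forall a, pre a c -> ~~ pre a d) ->
  forall x y, (0 < cnt x c)%N -> (0 < cnt y d)%N -> adj x y.
Proof.
elim/raag_pre_ind: c G => [|a c na IH] G pc pd dis x y; first by rewrite cnt1.
have pa : pre a G := pre_prefix (pre_self na) pc.
have [ad pd'] := prefix_disjoint_lett pa pd (dis a (pre_self na)).
have [G' eG nG'] := pre_split pa.
move: pc pd'; rewrite eG prefix_lettM // -lettV mulKg => pc pd'.
(* a letter initial in c and d is adjacent to a, so it was initial before a was removed *)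
have dis' e : pre e c -> ~~ pre e d.
  move=> pe; apply/negP => ped; have ea := ad _ (pre_cnt ped).
  by have := dis e; rewrite pre_lettM_adj ?pe ?ped 1?adj_sym // => /(_ isT).
rewrite cnt_lettM //; case: (a.1 =P x) => [<- _|_] /=; first exact: ad.
by apply: IH pc pd' dis' x y.
Qed.

Lemma prefix_strip c g h :
  (forall x y, (0 < cnt x c)%N -> (0 < cnt y g)%N -> adj x y) ->
  prefix c (g * h) -> prefix c h.
Proof.
elim/raag_pre_ind: c h => [|a c na IH] h cg pc; first exact: prefix1.
have ag : adj_all a g by move=> y; apply: cg; rewrite cnt_lettM // eqxx.
have pa : pre a h by rewrite -(pre_adj_allM h ag); apply: pre_prefix (pre_self na) pc.
have [h' eh nh'] := pre_split pa.
have ag' : adj_all (inv a) g by [].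
move: pc; rewrite eh mulgA -(lett_comm_adj_all ag) -mulgA !prefix_lettM //.
  by apply: IH => x y cx; apply: cg; rewrite cnt_lettM // addn_gt0 cx orbT.
by rewrite pre_adj_allM.
Qed.

(** Elements with a unique last letter are the principal ideals of the partial order in
which the letters of a reduced word occur; 1 satisfies this vacuously. *)
Definition last_only e c : Prop := forall a, pre a (rho c) -> a = e.

Lemma last_only_lettM a e c : ~~ pre (inv a) c -> last_only e (lett a * c) -> last_only e c.
Proof.
move=> na lc b pb; apply: lc; rewrite rhoM rho_lett pre_mulr //.
by rewrite -{1}(rho_lett a) -rhoM !len_rho len_lettM // len_lett addn1.
Qed.

Lemma last_only_mem e c : c <> 1 -> last_only e c -> pre e (rho c).
Proof.
move=> c1 lc; have /pre_exists[a pa] : rho c <> 1.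
  by move=> r1; apply: c1; rewrite -(rhoK c) r1 rho1.
by rewrite -(lc a pa).
Qed.

(** Principal ideals whose top letters do not commute are nested, as the top letters
are comparable. *)
Lemma prefix_comparable e e' c d G : last_only e c -> last_only e' d ->
  ~~ adj e.1 e'.1 -> prefix c G -> prefix d G -> prefix c d \/ prefix d c.
Proof.
move=> lc ld nadj; have [n] := ubnP (len c).
elim: n c d G lc ld => // n IH c d G lc ld lt pc pd.
case: (EM (exists2 a, pre a c & pre a d)) => [[a pac pad]|dis].
  have pa := pre_prefix pac pc.
  have [c' ec nc] := pre_split pac; have [d' ed nd] := pre_split pad.
  have [G' eG nG] := pre_split pa; rewrite ec in lc lt pc *.
  rewrite ed in ld pd *; rewrite eG !prefix_lettM // in pc pd *.
  rewrite len_lettM // ltnS in lt.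
  exact: IH (last_only_lettM nc lc) (last_only_lettM nd ld) lt pc pd.
case: (EM (c = 1)) => [->|c1]; first by left; apply: prefix1.
case: (EM (d = 1)) => [->|d1]; first by right; apply: prefix1.
exfalso; move/negP: nadj; apply.
apply: (prefix_disjoint pc pd).
- by move=> a pac; apply/negP => pad; apply: dis; exists a.
- by have := pre_cnt (last_only_mem c1 lc); rewrite cnt_rho.
- by have := pre_cnt (last_only_mem d1 ld); rewrite cnt_rho.
Qed.

Lemma preV_rho a g : pre a g^-1 = pre (inv a) (rho g).
Proof.
rewrite !preE inv_letterK lenV len_rho -lettV -invgM lenV.
by rewrite -{2}(rho_lett a) -rhoM len_rho.
Qed.

(** The letter [e] can only be cancelled after all of [d], because no letter of [d]
commutes with it. *)
Lemma cancel_forces e d G : (forall x, (0 < cnt x d)%N -> ~~ adj e.1 x) ->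
  ~~ pre (inv e) d -> pre (inv e) (d * G) -> prefix (lett e * d)^-1 G.
Proof.
have [n] := ubnP (len d); elim: n d G => // n IH d G lt nadj nd pG.
case: (lenM_cases d G) => [red|[a]].
  case: (pre_mul_cases red pG) => [pd|[ad pG']]; first by rewrite pd in nd.
  have d1 : d = 1.
    apply: contrapT => /pre_exists[b /pre_cnt cb].
    by have := nadj _ cb; rewrite (ad _ cb).
  by rewrite d1 mulg1 lettV prefix_lett.
move=> /pre_split[k ek nk] pa.
have ed : d = rho k * lett a by rewrite -(rhoK d) ek rhoM rho_lett.
have [G' eG nG] := pre_split pa.
have ld : len d = (len (rho k) + len (lett a))%N.
  by rewrite -len_rho ek len_lettM // len_rho len_lett addn1.
have edG : d * G = rho k * G' by rewrite ed eG -lettV -mulgA mulVKg.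
have : prefix (lett e * rho k)^-1 G'.
  apply: IH; rewrite -?edG //.
  - by move: lt; rewrite ld len_lett; lia.
  - move=> x hx; apply: nadj; rewrite ed cntM -?ed //.
    by rewrite addn_gt0 hx.
  - by apply: contra nd => pk; rewrite ed pre_mulr -?ed.
move/prefix_len; rewrite invgK lenV ed eG -lettV => h.
rewrite prefixE invgK lenV.
have -> : lett e * (rho k * lett a) * ((lett a)^-1 * G') = lett e * rho k * G'.
  by rewrite !mulgA mulgK.
have := lenM (lett e * rho k) (lett a); rewrite len_lett mulgA.
have -> : len ((lett a)^-1 * G') = (len G').+1 by rewrite lettV len_lettM.
by move=> le; rewrite h -addSn leq_add2r -[X in (_ <= X)%N]addn1.
Qed.
End PrefixOrder.

(** * Reading initial letters off an image *)

Section Halves.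
Variable Gamma : sgraph.
Implicit Types (a e : letter Gamma) (x y z : letter Gamma) (u v t s : Gamma).
Implicit Types (g h k c d G Y : raag Gamma).

Notation inv := (@inv_letter Gamma).

Variables (alpha : Defs.aut (raag Gamma)).
Variables (arm : letter Gamma -> raag Gamma) (centre : letter Gamma -> letter Gamma).
Hypothesis centre_vertex : forall y, (centre y).1 = y.1.
Hypothesis alpha_arm : forall y,
  alpha (lett y) = arm y * lett (centre y) * rho (arm y).
Hypothesis len_alpha : forall y, len (alpha (lett y)) = (2 * len (arm y)).+1.
Hypothesis armV : forall y, arm (inv y) = (rho (arm y))^-1.
Hypothesis centreV : forall y, centre (inv y) = inv (centre y).
Hypothesis alpha_nonadj : forall y t, (0 < cnt t (alpha (lett y)))%N -> ~~ adj y.1 t.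
Hypothesis alpha_adj : forall x y s t, adj x.1 y.1 ->
  (0 < cnt s (alpha (lett x)))%N -> (0 < cnt t (alpha (lett y)))%N -> adj s t.

(** No letter of the image is adjacent to the central letter here, so the half has a
unique last letter. *)
Definition half y : raag Gamma := arm y * lett (centre y).

Lemma alpha_half y : alpha (lett y) = half y * rho (arm y).
Proof. exact: alpha_arm. Qed.

Lemma len_half y : len (half y) = (len (arm y)).+1.
Proof.
have h1 := lenM (half y) (rho (arm y)); rewrite -alpha_half len_rho len_alpha in h1.
have h2 : (len (half y) <= len (arm y) + 1)%N.
  by rewrite -(len_lett (centre y)) lenM.
by lia.
Qed.

Lemma alpha_half_reduced y :
  len (half y * rho (arm y)) = (len (half y) + len (rho (arm y)))%N.
Proof. by rewrite -alpha_half len_alpha len_half len_rho; lia. Qed.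

Lemma half_reduced y : len (half y) = (len (arm y) + len (lett (centre y)))%N.
Proof. by rewrite len_half len_lett addn1. Qed.

Lemma prefix_half y : prefix (half y) (alpha (lett y)).
Proof. by rewrite alpha_half; apply: prefix_mulr; apply: alpha_half_reduced. Qed.

Lemma rho_half y : rho (half y) = lett (centre y) * rho (arm y).
Proof. by rewrite rhoM rho_lett. Qed.

Lemma centre_not_pre_arm y : ~~ pre (inv (centre y)) (rho (arm y)).
Proof.
apply/negP => /len_preV; rewrite inv_letterK -rho_half !len_rho len_half.
by lia.
Qed.

Lemma arm_nonadj y t : (0 < cnt t (arm y))%N -> ~~ adj y.1 t.
Proof.
move=> ct; apply: (alpha_nonadj (y := y)).
apply: leq_trans (prefix_cnt t (prefix_half y)).
by rewrite cntM ?half_reduced // addn_gt0 ct.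
Qed.

Lemma half_last_only y : last_only (centre y) (half y).
Proof.
move=> a; rewrite rho_half => pa; apply/eqP/negPn/negP => ne.
have pc := pre_self (centre_not_pre_arm y).
have adj_ac := pre_adj pa pc ne.
move: pa; rewrite pre_lettM_adj // => /pre_cnt; rewrite cnt_rho => /arm_nonadj.
by rewrite -(centre_vertex y) adj_sym adj_ac.
Qed.

Lemma half_neq1 y : half y <> 1.
Proof. by move=> e; have := len_half y; rewrite e len1. Qed.

Lemma half_inv y : (lett (centre y) * rho (arm y))^-1 = half (inv y).
Proof. by rewrite /half invgM armV centreV lettV. Qed.

(** The central letter of the first factor can only be cancelled together with the
whole second half, which is the inverse of the first half of the inverse letter. *)
Lemma prefix_half_mul y G : ~~ prefix (half (inv y)) G ->
  prefix (half y) (alpha (lett y) * G).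
Proof.
move=> np; rewrite alpha_half -mulgA; apply: prefix_mulr.
case: (lenM_cases (half y) (rho (arm y) * G)) => // -[a] /half_last_only -> pc.
exfalso; move/negP: np; apply; rewrite -half_inv; apply: cancel_forces pc.
  by move=> t; rewrite cnt_rho centre_vertex; apply: arm_nonadj.
exact: centre_not_pre_arm.
Qed.

Hypothesis no_prefix : forall x y, x != y -> ~~ prefix (half x) (half y).

(** For the converse, let [z] be an initial letter of [Y].  If [z] is adjacent to [y],
the image of [z] commutes with the half of [y] letter by letter and can be stripped
off.  If not, the halves of [y] and [z] are nested, which was excluded. *)
Lemma pre_alpha Y y : pre y Y <-> prefix (half y) (alpha Y).
Proof.
have [n] := ubnP (len Y); elim: n Y y => // n IH Y y lt.
(* the half of z survives, as its inverse is not initial in the rest of Y *)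
have fwd z : pre z Y -> prefix (half z) (alpha Y).
  move=> /pre_split[Y' eY nY]; rewrite eY aut_morph; apply: prefix_half_mul.
  have ltY : (len Y' < n)%N by move: lt; rewrite eY len_lettM.
  by apply/negP => /(proj2 (IH _ _ ltY)); rewrite (negPf nY).
split=> [|py]; first exact: fwd.
case: (EM (Y = 1)) => [eY|/pre_exists[z pz]].
  by move: py; rewrite eY aut1 => /prefix_of1/half_neq1.
case: (y =P z) => [->//|/eqP yz].
have pz' := fwd z pz.
have [yzadj|yznadj] := boolP (adj y.1 z.1).
  have [Y' eY nY] := pre_split pz.
  have ltY : (len Y' < n)%N by move: lt; rewrite eY len_lettM.
  rewrite eY pre_lettM_adj //; apply: (proj2 (IH _ _ ltY)).
  apply: (@prefix_strip _ _ (alpha (lett z))); last by rewrite -aut_morph -eY.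
  move=> s t cs ct; apply: (alpha_adj yzadj) ct.
  exact: leq_trans cs (prefix_cnt s (prefix_half y)).
have nadj : ~~ adj (centre y).1 (centre z).1 by rewrite !centre_vertex.
case: (prefix_comparable (half_last_only (y:=y)) (half_last_only (y:=z)) nadj py pz').
  by rewrite (negPf (no_prefix yz)).
by rewrite (negPf (no_prefix _)) // eq_sym.
Qed.

(** An initial letter [y] of the preimage of [u] has its half as a prefix of [u], so
this half is the single letter [u]. *)
Lemma no_prefix_len1 u : len (alpha (raag_gen u)) = 1%N.
Proof.
have [|y] := @pre_exists _ (alpha^-1 (raag_gen u)).
  move=> e; have := autVK alpha (raag_gen u); rewrite e aut1 => e1.
  by have := len_lett (u, false); rewrite lett_gen -e1 len1.
move=> py; have := proj1 (pre_alpha _ _) py; rewrite autVK => ph.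
have l1 : len (raag_gen u) = 1%N := len_lett (u, false).
have la : len (arm y) = 0%N.
  by have := prefix_len ph; rewrite l1 len_half; lia.
have yu : y.1 = u.
  have := prefix_cnt y.1 ph.
  rewrite /half (len_eq0 la) mul1g -{1}(centre_vertex y).
  rewrite -{1}[lett _]mulg1 cnt_lettM ?pre1 // eqxx cnt1.
  rewrite -lett_gen -{1}[lett (u, _)]mulg1 cnt_lettM ?pre1 // cnt1 /=.
  by case: eqP.
have h : len (alpha (lett y)) = 1%N by rewrite len_alpha la.
case: y {py ph la} yu h => v [] /= -> ; rewrite ?lett_genV ?autV ?lenV //.
Qed.
End Halves.

(** * Existence of a shortening move *)

Section Shortening.
Variable Gamma : sgraph.
Implicit Types (x y z : letter Gamma) (u v t s : Gamma).
Variables (alpha : Defs.aut (raag Gamma)).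
Hypothesis alpha_pal : palindromic_over 1%g alpha.

Notation inv := (@inv_letter Gamma).

(** The arms of a letter and of its inverse have to correspond for the cancellation
argument; they are chosen for the vertices and transported. *)
Lemma alpha_decomp : exists (arm : letter Gamma -> raag Gamma)
    (centre : letter Gamma -> letter Gamma),
  [/\ forall y, (centre y).1 = y.1,
      forall y, alpha (lett y) = arm y * lett (centre y) * rho (arm y),
      forall y, len (alpha (lett y)) = (2 * len (arm y)).+1,
      forall y, arm (inv y) = (rho (arm y))^-1 &
      forall y, centre (inv y) = inv (centre y)].
Proof.
have /choice[f hf] : forall u, exists be : raag Gamma * bool,
    alpha (raag_gen u) = be.1 * lett (u, be.2) * rho be.1 /\
    len (alpha (raag_gen u)) = (2 * len be.1).+1.
  move=> u; have [ru pu] := palindromic_over_gen u alpha_pal.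
  rewrite perm1 in pu.
  by have [_ /(_ u pu)[b [e h]]] := rho_fixed_decomp ru; exists (b, e).
exists (fun y => if y.2 then (rho (f y.1).1)^-1 else (f y.1).1).
exists (fun y => (y.1, (f y.1).2 (+) y.2)); split=> [//|[u []]|[u []]|[u []]|[u []]] /=.
- have [h _] := hf u.
  by rewrite lett_genV autV h !invgM lettV rhoV rhoK addbT mulgA.
- by have [h _] := hf u; rewrite addbF.
- by have [_ h] := hf u; rewrite lett_genV autV !lenV len_rho.
- by have [_ h] := hf u.
- by rewrite rhoV rhoK invgK.
- by [].
- by rewrite /inv_letter /= addbF addbT negbK.
- by rewrite /inv_letter /= addbT addbF.
Qed.

Lemma alpha_support u v : (0 < cnt v (alpha (raag_gen u)))%N ->
  v = u \/ dominated_by u v.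
Proof.
by case: (v =P u) => [->|/eqP vu] cv; [left|right; apply: support_dominates cv].
Qed.

(** If the half [c] of [x] is a proper prefix of the half of [y], then
[alpha y = c * k * rho c] for some [k] fixed by reversal; multiplying by the inverse
of [alpha x] on both sides replaces [c] by the arm of [x], which is one letter
shorter. *)
Lemma shortening_step :
  (forall u v, (0 < cnt v (alpha (raag_gen u)))%N -> ~~ adj u v) ->
  (forall u, len (alpha (raag_gen u)) = 1%N) \/
  exists u v e, [/\ u != v, dominated_by u v &
    (len (alpha (lett (v, e)) * alpha (raag_gen u) * alpha (lett (v, e)))
      < len (alpha (raag_gen u)))%N].
Proof.
move=> nadj; have [arm [centre [cv aa la aV cV]]] := alpha_decomp.
have cntE y t : cnt t (alpha (lett y)) = cnt t (alpha (raag_gen y.1)).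
  by case: y => w []; rewrite ?lett_genV ?autV ?cntV.
have nadj' y t : (0 < cnt t (alpha (lett y)))%N -> ~~ adj y.1 t.
  by rewrite cntE; apply: nadj.
have adj' x y s t : adj x.1 y.1 ->
    (0 < cnt s (alpha (lett x)))%N -> (0 < cnt t (alpha (lett y)))%N -> adj s t.
  move=> xy; rewrite (cntE x) (cntE y) => cs ct.
  have sy : adj s y.1.
    case: (alpha_support cs) => [->//|/fintype.subsetP/(_ y.1)].
    rewrite !inE xy => /(_ isT)/orP[/eqP e|//].
    by have := nadj _ _ cs; rewrite -e xy.
  case: (alpha_support ct) => [->//|/fintype.subsetP/(_ s)].
  rewrite !inE adj_sym sy => /(_ isT)/orP[/eqP e|]; last by rewrite adj_sym.
  by have := nadj _ _ ct; rewrite -e adj_sym sy.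
case: (EM (exists x y, x != y /\ prefix (half arm centre x) (half arm centre y))); last first.
  move=> np; left=> u; apply: (@no_prefix_len1 _ _ arm centre) => // x y xy.
  by apply/negP => pxy; apply: np; exists x, y.
case=> x [y [xy pxy]]; right.
have phy : prefix (half arm centre x) (alpha (lett y)).
  by apply: prefix_trans pxy _; apply: prefix_half.
have xy1 : x.1 != y.1.
  apply/eqP => e.
  have exy : x = inv y.
    case: x y e xy {pxy phy} => u d [v d'] /= -> h; rewrite /inv_letter /=.
    by congr (_, _); case: d d' h => [] [] //; rewrite eqxx.
  have [a pa] : exists a, pre a (half arm centre x).
    by apply/pre_exists/half_neq1.
  have p1 := pre_prefix pa phy.
  have p2 : pre a (alpha (lett x)) by apply: pre_prefix pa _; apply: prefix_half.
  move: p2; rewrite exy -lettV autV preV_rho.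
  have [hr _] := alpha_pal; rewrite hr rho_lett.
  by rewrite (negPf (pre_conflict p1)).
have lo z : last_only (centre z) (half arm centre z) by apply: half_last_only.
have pl z : pre (centre z) (rho (half arm centre z)).
  by apply: last_only_mem (lo z); apply: half_neq1.
have lh z : len (half arm centre z) = (len (arm z)).+1 by apply: len_half.
pose c := half arm centre x; pose m := c^-1 * half arm centre y.
have em : half arm centre y = c * m by rewrite mulVKg.
have lm : len (half arm centre y) = (len c + len m)%N by exact: prefix_len.
have m1 : m <> 1.
  move=> e; have ec : half arm centre y = c by rewrite em e mulg1.
  move: xy1; rewrite -(cv x) -(cv y) (lo y (centre x)) ?eqxx //.
  by rewrite ec; apply: pl.
have lom : last_only (centre y) m.
  move=> a pa; apply: (lo y); rewrite em rhoM; apply: pre_mulr => //.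
  by rewrite -rhoM !len_rho -em lm addnC.
have [r er nr] := pre_split (last_only_mem m1 lom).
have erm : m = rho r * lett (centre y) by rewrite -(rhoK m) er rhoM rho_lett.
have lmr : len m = (len r).+1 by rewrite -len_rho er len_lettM.
have ay : arm y = c * rho r.
  by apply: (mulIg (lett (centre y))); rewrite -mulgA -erm -em.
have short : (len (alpha (lett (inv x)) * alpha (lett y) * alpha (lett (inv x)))
    < len (alpha (lett y)))%N.
  have -> : alpha (lett (inv x)) * alpha (lett y) * alpha (lett (inv x)) =
      (rho (arm x))^-1 * (rho r * lett (centre y) * r) * (arm x)^-1.
    have ax : alpha (lett x) = c * rho (arm x) by rewrite aa.
    have ax' : alpha (lett x) = arm x * rho c.
      by rewrite aa /c /half rhoM rho_lett mulgA.
    rewrite -lettV autV {1}ax ax' aa ay rhoM rhoK !invgM !mulgA.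
    by rewrite mulgVK mulgVK mulgK.
  have l1 : len (alpha (lett y)) = (2 * len (arm x) + 2 * len r).+3.
    by rewrite la; move: (lh y); rewrite lm lmr /c lh; lia.
  rewrite l1; apply: (@leq_ltn_trans (len (arm x) + (len r + 1 + len r) + len (arm x))%N).
    apply: leq_trans (lenM _ _) _; rewrite lenV leq_add2r.
    apply: leq_trans (lenM _ _) _; rewrite lenV len_rho leq_add2l.
    apply: leq_trans (lenM _ _) _; rewrite leq_add2r.
    by apply: leq_trans (lenM _ _) _; rewrite len_rho len_lett.
  by lia.
have dom : dominated_by y.1 x.1.
  have : (0 < cnt x.1 (alpha (raag_gen y.1)))%N.
    rewrite -cntE; apply: leq_trans (prefix_cnt _ phy).
    by have := pre_cnt (pl x); rewrite cv cnt_rho.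
  by case/alpha_support => // e; rewrite e eqxx in xy1.
case: y xy1 short dom {xy pxy phy em lm m1 lom er nr erm lmr ay m r} => u [] xy1 short dom.
  exists u, x.1, x.2; split=> //; first by rewrite eq_sym.
  rewrite -surjective_pairing -(lenV (_ * _ * _)) !invgM -!autV.
  rewrite -(lenV (alpha (raag_gen u))) -!autV lettV -lett_genV mulgA; exact: short.
by exists u, x.1, (~~ x.2); split=> //; rewrite eq_sym.
Qed.
End Shortening.

(** * Exponent sums, isolated letters and domination *)

Section Exponents.
Variable Gamma : sgraph.
Implicit Types (a : letter Gamma) (x y u v z t : Gamma).
Implicit Types (g h : raag Gamma).

Notation inv := (@inv_letter Gamma).

Definition word_exponent y (w : word Gamma) : int :=
  ((count_mem (y, false) w)%:Z - (count_mem (y, true) w)%:Z)%R.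

Lemma raag_cong_exponent y (w z : word Gamma) : raag_cong w z ->
  word_exponent y w = word_exponent y z.
Proof.
elim=> {w z} //.
- by move=> w1 w2 w3 _ -> _ ->.
- move=> w1 w1' w2 w2' _ h1 _ h2; move: h1 h2.
  by rewrite /word_exponent !count_cat; lia.
- move=> u b; rewrite /word_exponent /= !xpair_eqE.
  by case: (u == y); case: b.
- move=> u v _; rewrite /word_exponent /= !xpair_eqE.
  by case: (u == y); case: (v == y).
Qed.

Definition exponent y g : int := word_exponent y (nf g).

Lemma exponent_class y (w : word Gamma) :
  exponent y (raag_class w) = word_exponent y w.
Proof. by apply: raag_cong_exponent; apply/raag_classP; rewrite nfK. Qed.

Lemma exponentM y g h : exponent y (g * h) = (exponent y g + exponent y h)%R.
Proof.
rewrite -{1}(nfK g) -{1}(nfK h) -class_cat exponent_class.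
by rewrite /exponent /word_exponent !count_cat; lia.
Qed.

Lemma exponent1 y : exponent y 1 = 0%R.
Proof. exact: (exponent_class y [::]). Qed.

Lemma exponentV y g : exponent y g^-1 = (- exponent y g)%R.
Proof. by have := exponentM y g g^-1; rewrite mulgV exponent1; lia. Qed.

Lemma exponent_lett y a :
  exponent y (lett a) = (if a.1 == y then (if a.2 then -1 else 1) else 0)%R.
Proof.
rewrite exponent_class /word_exponent /=; case: a => u b; rewrite !xpair_eqE /=.
by case: (u == y); case: b.
Qed.

Lemma exponent_gen y u : exponent y (raag_gen u) = ((u == y)%:Z)%R.
Proof. by have := exponent_lett y (u, false); rewrite lett_gen => ->; case: (u == y). Qed.

Lemma cnt_split y g :
  cnt y g = (count_mem (y, false) (nf g) + count_mem (y, true) (nf g))%N.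
Proof.
rewrite /cnt; elim: (nf g) => //= -[u b] w ->; rewrite !xpair_eqE.
by case: (u == y); case: b => /=; lia.
Qed.

Lemma odd_exponent y g : odd `|exponent y g|%N = par y g.
Proof.
rewrite /par cnt_split /exponent /word_exponent.
by move: (count_mem _ _) (count_mem _ _) => m n; lia.
Qed.

Lemma exponent_cnt0 y g : cnt y g = 0%N -> exponent y g = 0%R.
Proof. by rewrite cnt_split /exponent /word_exponent; lia. Qed.

Lemma cnt_exponent y g : exponent y g <> 0%R -> (0 < cnt y g)%N.
Proof. by move=> e; rewrite lt0n; apply/eqP => /exponent_cnt0. Qed.

Definition isolated y g : Prop :=
  forall z, (0 < cnt z g)%N -> z != y -> adj y z.

Lemma isolated_lettM y a h : ~~ pre (inv a) h -> isolated y (lett a * h) ->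
  isolated y h /\ (a.1 != y -> adj y a.1).
Proof.
move=> na iso; split=> [z hz|]; apply: iso; rewrite cnt_lettM ?eqxx //.
by rewrite addn_gt0 hz orbT.
Qed.

Lemma isolated_pre y g : isolated y g -> (0 < cnt y g)%N -> exists b, pre (y, b) g.
Proof.
elim/raag_pre_ind: g => [|a h na IH] iso; first by rewrite cnt1.
have [ih ia] := isolated_lettM na iso; rewrite cnt_lettM //.
case: (a.1 =P y) => [e _|/eqP ne /= /(IH ih)[b pb]]; last first.
  by exists b; rewrite pre_lettM_adj //=; apply: ia.
by exists a.2; rewrite -e -surjective_pairing; apply: pre_self.
Qed.

(** All occurrences of an isolated letter have the same sign, as opposite ones would
meet and cancel. *)
Lemma isolated_sign y g b : isolated y g -> pre (y, b) g ->
  exponent y g = (if b then - (cnt y g)%:Z else (cnt y g)%:Z)%R.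
Proof.
elim/raag_pre_ind: g b => [|a h na IH] b iso; first by rewrite pre1.
have [ih ia] := isolated_lettM na iso.
rewrite exponentM cnt_lettM // exponent_lett.
have [e|ne] := eqVneq a.1 y; last first.
  by rewrite pre_lettM_adj ?ia // => /(IH _ ih) ->; rewrite GRing.add0r.
move=> pb; have eb : a.2 = b.
  apply/eqP/negPn/negP => ab; have := pre_adj pb (pre_self na).
  rewrite /= e adj_irrefl => /(_ _)/notF; apply.
  by apply/eqP => ea; rewrite -ea eqxx in ab.
rewrite eb; case: (posnP (cnt y h)) => [c0|/(isolated_pre ih)[b' pb']].
  by rewrite c0 (exponent_cnt0 c0); case: b {pb eb}.
have eb' : b' = b.
  apply/eqP/negPn/negP => bb; move/negP: na; apply; rewrite /inv_letter e eb.
  by move: bb pb'; case: b {pb eb} b' => [] [].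
by rewrite (IH _ ih pb') eb'; case: b {pb eb eb'}; lia.
Qed.

Lemma isolated_exponent y g : isolated y g -> `|exponent y g|%N = cnt y g.
Proof.
move=> iso; case: (posnP (cnt y g)) => [c0|/(isolated_pre iso)[b pb]].
  by rewrite c0 (exponent_cnt0 c0).
by rewrite (isolated_sign iso pb); case: b {pb}; lia.
Qed.

Lemma len_single y g : (forall z, (0 < cnt z g)%N -> z = y) -> len g = cnt y g.
Proof.
elim/raag_pre_ind: g => [|a h na IH] only; first by rewrite len1 cnt1.
rewrite len_lettM // cnt_lettM // (only a.1) ?cnt_lettM ?eqxx // IH // => z hz.
by apply: only; rewrite cnt_lettM // addn_gt0 hz orbT.
Qed.

(** The matrix of [alpha] on the abelianisation, which Euclid's algorithm works on. *)
Lemma exponent_aut y (alpha : Defs.aut (raag Gamma)) g :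
  exponent y (alpha g) =
  (\sum_(u : Gamma) exponent y (alpha (raag_gen u)) * exponent u g)%R.
Proof.
have e1 u : exponent u (raag_gen u) = 1%R by rewrite exponent_gen eqxx.
have e0 u v : v != u -> exponent v (raag_gen u) = 0%R.
  by rewrite exponent_gen eq_sym => /negPf->.
elim/raag_gen_ind: g => [|u g IH|u g IH].
- by rewrite aut1 exponent1 big1 // => u _; rewrite exponent1 GRing.mulr0.
- rewrite aut_morph exponentM IH [in RHS](bigD1 u) //= [in LHS](bigD1 u) //=.
  rewrite exponentM e1 (GRing.mulrDr _ 1%R) GRing.mulr1 -[RHS]GRing.addrA.
  congr (_ + (_ + _))%R; apply: eq_bigr => v vu.
  by rewrite exponentM e0 // GRing.add0r.
- rewrite aut_morph exponentM IH [in RHS](bigD1 u) //= [in LHS](bigD1 u) //=.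
  rewrite autV exponentM !exponentV e1 (GRing.mulrDr _ (-1)%R) GRing.mulrN1 -[RHS]GRing.addrA.
  congr (_ + (_ + _))%R; apply: eq_bigr => v vu.
  by rewrite exponentM exponentV e0 // GRing.oppr0 GRing.add0r.
Qed.

Lemma dominated_refl u : dominated_by u u.
Proof. by apply/fintype.subsetP => z; rewrite !inE orbC => ->. Qed.

Lemma dominated_trans v u z : dominated_by u v -> dominated_by v z -> dominated_by u z.
Proof.
move=> /fintype.subsetP uv /fintype.subsetP vz; apply/fintype.subsetP => x ux.
have := uv x ux; rewrite !inE => /orP[/eqP ex|vx]; last by have := vz x; rewrite !inE; apply.
rewrite {x}ex inE in ux *; have := vz u; rewrite !inE adj_sym => /(_ ux).
case/orP=> [/eqP <-|zu]; first by rewrite ux orbT.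
have := uv z; rewrite !inE adj_sym zu => /(_ isT)/orP[/eqP ->|vz']; first by rewrite eqxx.
by rewrite adj_sym vz' orbT.
Qed.

(** The vertices whose images only involve pairwise commuting letters, once the
permutation modulo 2 is trivial. *)
Definition abelian_vertex v : bool :=
  [forall t, dominated_by v t ==> (t != v) ==> adj v t].

Lemma abelian_vertexP v : reflect
  (forall t, dominated_by v t -> t != v -> adj v t) (abelian_vertex v).
Proof.
apply: (iffP forallP) => h t; first by move=> d n; have := h t; rewrite d n.
by apply/implyP => d; apply/implyP => n; apply: h.
Qed.

(** Consequently, the letters of [alpha u] that are adjacent to [u] sit at abelian
vertices, whose images are brought to length one first. *)
Lemma adj_dominator_abelian u v : adj u v -> dominated_by u v -> abelian_vertex v.
Proof.
move=> uv /fintype.subsetP duv; apply/abelian_vertexP => t /fintype.subsetP dvt tv.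
have := dvt u; rewrite !inE adj_sym uv => /(_ isT)/orP[/eqP<-|tu].
  by rewrite adj_sym.
by have := duv t; rewrite !inE adj_sym tu (negPf tv) => /(_ isT).
Qed.

Lemma abelian_vertex_up v t : abelian_vertex v -> dominated_by v t -> abelian_vertex t.
Proof.
have [->//|tv] := eqVneq t v.
by move=> /abelian_vertexP av vt; apply: adj_dominator_abelian (av t vt tv) vt.
Qed.
End Exponents.

(** * Reduction of automorphisms that permute no vertex modulo 2 *)

Section Generation.
Variable Gamma : sgraph.
Implicit Types (x y u v w z t : Gamma) (alpha beta : Defs.aut (raag Gamma)).
Implicit Types (g h : raag Gamma).

Variables (fixed : Gamma -> Prop) (H : set (Defs.aut (raag Gamma))).

Definition fixing alpha : Prop :=
  forall v, fixed v -> alpha (raag_gen v) = raag_gen v.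

Hypothesis H_subgroup : is_subgroup H.
Hypothesis H_inversion : forall alpha, inversion alpha -> fixing alpha -> H alpha.
Hypothesis H_transvection : forall alpha,
  dominated_elementary_palindromic alpha -> fixing alpha -> H alpha.

(** The automorphisms that remain once the diagram part is split off. *)
Definition admissible alpha : Prop := palindromic_over 1%g alpha /\ fixing alpha.

Lemma in_H_mulr alpha beta : H beta -> H (alpha * beta) -> H alpha.
Proof.
case: H_subgroup => _ HM HV hb hab; rewrite -[alpha](mulgK beta).
by apply: HM => //; apply: HV.
Qed.

Lemma admissibleM alpha beta :
  admissible alpha -> admissible beta -> admissible (alpha * beta).
Proof.
move=> [pa fa] [pb fb]; split; last by move=> v fv; rewrite aut_mulE fb ?fa.
by have := palindromic_overM pa pb; rewrite mulg1.
Qed.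

Lemma transvection_in_H u v (e : bool) : u != v -> dominated_by u v -> ~ fixed u ->
  exists beta, [/\ H beta, admissible beta,
    beta (raag_gen u) = lett (v, e) * raag_gen u * lett (v, e) &
    forall w, w != u -> beta (raag_gen w) = raag_gen w].
Proof.
move=> uv duv nfu.
suff [beta [Hb bu bw]] : exists beta, [/\ H beta,
    beta (raag_gen u) = lett (v, e) * raag_gen u * lett (v, e) &
    forall w, w != u -> beta (raag_gen w) = raag_gen w].
  exists beta; split=> //; split; last first.
    by move=> w fw; apply: bw; apply/eqP => ew; rewrite ew in fw.
  apply: palindromic_over_gens => [w|w x]; have [->|wu] := eqVneq w u.
  - by rewrite bu !rhoM !(rho_lett (v, e)) (rho_lett (u, false)) mulgA.
  - by rewrite bw // (rho_lett (w, false)).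
  - rewrite bu !parM !(par_lett x (v, e)) (par_lett x (u, false)) perm1 /=.
    by case: (v == x); case: (u == x).
  - by rewrite bw // (par_lett x (w, false)) perm1.
have [alpha [au aw]] := transvection_exists false uv duv.
have Ha : H alpha.
  apply: H_transvection; first by exists u, v; split.
  by move=> w fw; apply: aw; apply/eqP => ew; rewrite ew in fw.
case: e; last by exists alpha.
have vu : v != u by rewrite eq_sym.
exists alpha^-1; split; first by case: H_subgroup => _ _; apply.
  apply: (can_inj (autK alpha)); rewrite autVK lett_genV !aut_morph !autV.
  by rewrite aw // au lett_gen !mulgA mulVg mul1g mulgK.
by move=> w wu; apply: (can_inj (autK alpha)); rewrite autVK aw.
Qed.

(** One move: the membership of [alpha] in the subgroup [H] is reduced to that of an
automorphism with one modified image. *)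
Lemma transvect alpha u v (e : bool) : admissible alpha ->
  u != v -> dominated_by u v -> ~ fixed u ->
  exists beta, [/\ admissible beta, (H beta -> H alpha),
    beta (raag_gen u) =
      alpha (lett (v, e)) * alpha (raag_gen u) * alpha (lett (v, e)) &
    forall w, w != u -> beta (raag_gen w) = alpha (raag_gen w)].
Proof.
move=> aa uv duv nfu; have [tau [Ht at' tu tw]] := transvection_in_H e uv duv nfu.
exists (alpha * tau); split=> [|h||w wu]; first exact: admissibleM.
- exact: in_H_mulr Ht h.
- by rewrite aut_mulE tu !aut_morph.
- by rewrite aut_mulE tw.
Qed.

Lemma len1_signed alpha u : palindromic_over 1%g alpha ->
  len (alpha (raag_gen u)) = 1%N -> exists b : bool, alpha (raag_gen u) = lett (u, b).
Proof.
move=> pa l1; have [ru pu] := palindromic_over_gen u pa; rewrite perm1 in pu.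
have [_ /(_ u pu)[b [e [eg lg]]]] := rho_fixed_decomp ru.
by exists e; rewrite eg (@len_eq0 _ b) ?rho1 ?mulg1 ?mul1g //; lia.
Qed.

(** Each vertex that is inverted is corrected by an inversion; it is not fixed by
[alpha], so this inversion fixes the required vertices. *)
Lemma signed_in_H alpha : admissible alpha ->
  (forall u, len (alpha (raag_gen u)) = 1%N) -> H alpha.
Proof.
have [n] := ubnP #|[set u | alpha (raag_gen u) != raag_gen u]%SET|.
elim: n alpha => // n IH alpha lt aa l1.
case: (EM (forall u, alpha (raag_gen u) = raag_gen u)) => [id_alpha|].
  by rewrite (_ : alpha = 1); [case: H_subgroup | apply: aut_gen_ext].
move=> /existsNP[u nu].
have [b eb] := len1_signed aa.1 (l1 u).
have {}eb : alpha (raag_gen u) = (raag_gen u)^-1.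
  by case: b eb nu => -> // _; rewrite lett_genV.
have [iota [iu iw]] := inversion_exists u.
have fi : fixing iota.
  by move=> w fw; apply: iw; apply/eqP => ew; rewrite ew in fw; have := aa.2 u fw.
have pi : palindromic_over 1%g iota.
  apply: palindromic_over_gens => [w|w x]; have [->|wu] := eqVneq w u.
  - by rewrite iu rhoV (rho_lett (u, false)).
  - by rewrite iw // (rho_lett (w, false)).
  - by rewrite iu parV (par_lett x (u, false)) perm1.
  - by rewrite iw // (par_lett x (w, false)) perm1.
have Hi : H iota by apply: H_inversion => //; exists u.
have eu : (alpha * iota) (raag_gen u) = raag_gen u.
  by rewrite aut_mulE iu autV eb invgK.
have ew w : w != u -> (alpha * iota) (raag_gen w) = alpha (raag_gen w).
  by move=> wu; rewrite aut_mulE iw.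
apply: in_H_mulr Hi _; apply: IH; last 1 first.
- by move=> w; have [->|wu] := eqVneq w u; [rewrite eu (len_lett (u, false))|rewrite ew].
- apply: leq_trans (_ : #|[set w | alpha (raag_gen w) != raag_gen w]%SET| <= n)%N; last by [].
  apply/proper_card/fintype.properP; split.
    apply/fintype.subsetP => w; rewrite !inE.
    by have [->|wu] := eqVneq w u; [rewrite eu eqxx|rewrite ew].
  by exists u; rewrite !inE ?eu ?eqxx //; apply/eqP.
- exact: admissibleM.
Qed.

(** The letter [y] commutes with the whole image of [u], since all other letters
of this image dominate [u].  It occurs on both sides of the centre, so two occurrences
of it can be removed. *)
Lemma shorten_by_adjacent alpha u y : admissible alpha ->
  adj u y -> len (alpha (raag_gen y)) = 1%N -> (0 < cnt y (alpha (raag_gen u)))%N ->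
  exists e : bool, (len (alpha (lett (y, e)) * alpha (raag_gen u) * alpha (lett (y, e)))
    < len (alpha (raag_gen u)))%N.
Proof.
move=> aa uy l1 cy; have [ru pu] := palindromic_over_gen u aa.1; rewrite perm1 in pu.
have [_ /(_ u pu)[b [e [eg lg]]]] := rho_fixed_decomp ru.
have yu : y != u by apply/eqP => e'; rewrite e' adj_irrefl in uy.
have cb : (0 < cnt y b)%N.
  move: cy; rewrite eg; apply: contraTT; rewrite -!leqNgt !leqn0 => /eqP cb0.
  have h1 := leq_cntM y (b * lett (u, e)) (rho b).
  have h2 := leq_cntM y b (lett (u, e)).
  have h3 : cnt y (lett (u, e)) = 0%N.
    by rewrite -[lett _]mulg1 cnt_lettM ?pre1 // cnt1 /= eq_sym (negPf yu).
  by rewrite cnt_rho cb0 in h1; rewrite cb0 h3 in h2; rewrite -leqn0; lia.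
have pb : prefix b (alpha (raag_gen u)).
  rewrite prefixE {1}eg -mulgA mulKg.
  have := lenM (lett (u, e)) (rho b); rewrite len_lett len_rho lg => h.
  by move: h; move: (len _) => m; lia.
have iso : isolated y b.
  move=> z cz zy; have := support_dominates (u := u) (v := z) aa.1.
  have [->|zu _] := eqVneq z u; first by rewrite adj_sym uy.
  have : dominated_by u z.
    by apply: support_dominates aa.1 zu _; apply: leq_trans cz (prefix_cnt z pb).
  move=> /fintype.subsetP/(_ y); rewrite !inE uy => /(_ isT)/orP[/eqP ey|].
    by rewrite ey eqxx in zy.
  by rewrite adj_sym.
have [d pd] := isolated_pre iso cb; have [b' eb nb] := pre_split pd.
have [f ef] := len1_signed aa.1 l1.
(* the sign for which the image of the letter is the inverse of (y, d) *)
exists (f (+) ~~ d).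
have -> : alpha (lett (y, f (+) ~~ d)) = (lett (y, d))^-1.
  by case: d {pd eb nb} f ef => [] [] ef; rewrite lettV /inv_letter /= ?lett_genV
    ?autV ?lett_gen ef ?lettV.
rewrite lg eg eb rhoM rho_lett !mulgA mulVg mul1g mulgK len_lettM //.
apply: (@leq_ltn_trans (len b' + 1 + len b')%N); last by lia.
apply: leq_trans (lenM _ _) _; rewrite len_rho leq_add2r.
by apply: leq_trans (lenM _ _) _; rewrite len_lett.
Qed.

(** Shortening moves never touch a vertex whose image has length one: parity shows
that the new image is not trivial. *)
Lemma abelian_signed_in_H alpha : admissible alpha ->
  (forall v, abelian_vertex v -> len (alpha (raag_gen v)) = 1%N) -> H alpha.
Proof.
have [n] := ubnP (\sum_(u : Gamma) len (alpha (raag_gen u)))%N.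
elim: n alpha => // n IH alpha lt aa ab.
suff [|[u [v [e [uv duv short]]]]] : (forall u, len (alpha (raag_gen u)) = 1%N) \/
    exists u v e, [/\ u != v, dominated_by u v &
    (len (alpha (lett (v, e)) * alpha (raag_gen u) * alpha (lett (v, e)))
      < len (alpha (raag_gen u)))%N].
- exact: signed_in_H.
- (* the class modulo 2 shows that the new image of u is not trivial *)
  have long : (1 < len (alpha (raag_gen u)))%N.
    apply: leq_ltn_trans short; rewrite lt0n; apply/eqP => /len_eq0.
    move=> /(congr1 (par u)); rewrite par1 !parM.
    have [_ ->] := palindromic_over_gen u aa.1.
    by rewrite perm1 eqxx; case: (par u _).
  have nfu : ~ fixed u.
    by move=> fu; have := aa.2 u fu => e'; rewrite e' (len_lett (u, false)) in long.
  have nab : ~ abelian_vertex u by move=> /ab l1; rewrite l1 in long.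
  have [beta [ba bH bu bw]] := transvect e aa uv duv nfu.
  apply: bH; apply: IH => //.
    apply: leq_trans (_ : \sum_w len (alpha (raag_gen w)) <= n)%N; last by [].
    rewrite (bigD1 u) //= [X in (_ < X)%N](bigD1 u) //= bu -addSn leq_add //.
    by apply: leq_sum => w /bw ->.
  move=> w aw; rewrite bw; first exact: ab.
  by apply/eqP => ew; rewrite ew in aw.
case: (EM (exists u v, (0 < cnt v (alpha (raag_gen u)))%N /\ adj u v)); last first.
  move=> na; apply: shortening_step aa.1 _ => u v cv; apply/negP => uv.
  by apply: na; exists u, v.
case=> u [v [cv uv]]; right.
have vu : v != u by apply/eqP => e; rewrite e adj_irrefl in uv.
have duv := support_dominates aa.1 vu cv.
have [e short] := shorten_by_adjacent aa uv (ab v (adj_dominator_abelian uv duv)) cv.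
by exists u, v, e; split; rewrite // eq_sym.
Qed.

(** Only the columns of abelian vertices matter: the other ones are treated by length. *)
Definition row_cleared alpha y : Prop := forall u, abelian_vertex u -> u != y ->
  exponent y (alpha (raag_gen u)) = 0%R.

Lemma diagonal_odd alpha y : palindromic_over 1%g alpha ->
  odd `|exponent y (alpha (raag_gen y))|%N.
Proof.
by move=> pa; rewrite odd_exponent; have [_ ->] := palindromic_over_gen y pa; rewrite perm1 eqxx.
Qed.

Lemma offdiagonal_even alpha y u : palindromic_over 1%g alpha -> u != y ->
  odd `|exponent y (alpha (raag_gen u))|%N = false.
Proof.
move=> pa /negPf uy; rewrite odd_exponent; have [_ ->] := palindromic_over_gen u pa.
by rewrite perm1 uy.
Qed.

(** The preimage [k] of [y] only involves abelian vertices.  Comparing exponents of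
[alpha k = y] at the rows of [D] removes the vertices of [D] from [k], and the row of
[y] then says that the diagonal entry divides 1. *)
Lemma diagonal_unit alpha y (D : {set Gamma}) : palindromic_over 1%g alpha ->
  abelian_vertex y -> y \notin D -> (forall d, d \in D -> row_cleared alpha d) ->
  (forall u, abelian_vertex u -> u \notin D -> u != y ->
     exponent y (alpha (raag_gen u)) = 0%R) ->
  `|exponent y (alpha (raag_gen y))|%N = 1%N.
Proof.
move=> pa aby yD rD ry; pose k := alpha^-1 (raag_gen y).
have pa' : palindromic_over 1%g alpha^-1.
  by have := palindromic_overV pa; rewrite invg1.
have k_ab u : exponent u k <> 0%R -> abelian_vertex u.
  move=> /cnt_exponent cu; have [->//|uy] := eqVneq u y.
  exact: abelian_vertex_up aby (support_dominates pa' uy cu).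
have k_nab u : ~~ abelian_vertex u -> exponent u k = 0%R.
  by move=> nab; apply: contrapT => /k_ab abu; rewrite abu in nab.
have k_D d : d \in D -> exponent d k = 0%R.
  move=> dD; have [abd|/k_nab//] := boolP (abelian_vertex d).
  have dy : d != y by apply/eqP => e; rewrite -e dD in yD.
  have := exponent_aut d alpha k; rewrite autVK exponent_gen eq_sym (negPf dy).
  rewrite (bigD1 d) //= big1 => [|u ud]; last first.
    have [abu|/k_nab->] := boolP (abelian_vertex u); last by rewrite GRing.mulr0.
    by rewrite (rD d dD u abu ud) GRing.mul0r.
  by have := diagonal_odd d pa; nia.
have := exponent_aut y alpha k; rewrite autVK exponent_gen eqxx.
rewrite (bigD1 y) //= big1 => [|u uy]; last first.
  have [abu|/k_nab->] := boolP (abelian_vertex u); last by rewrite GRing.mulr0.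
  have [uD|uD] := boolP (u \in D); first by rewrite k_D ?GRing.mulr0.
  by rewrite (ry u abu uD uy) GRing.mul0r.
rewrite GRing.addr0 => e; have := congr1 absz e; rewrite abszM /=.
by move/esym/eqP; rewrite muln_eq1 => /andP[/eqP].
Qed.

(** Column [w] plus or minus twice column [v].  The condition on [z] says which rows
are unaffected. *)
Lemma euclid_step alpha y v w : admissible alpha -> w != v -> dominated_by w v ->
  ~ fixed w -> (0 < `|exponent y (alpha (raag_gen v))|
                  < `|exponent y (alpha (raag_gen w))|)%N ->
  exists beta, [/\ admissible beta, (H beta -> H alpha),
    (`|exponent y (beta (raag_gen w))| < `|exponent y (alpha (raag_gen w))|)%N,
    forall z, exponent z (alpha (raag_gen v)) = 0%R ->
      exponent z (beta (raag_gen w)) = exponent z (alpha (raag_gen w)) &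
    forall u, u != w -> beta (raag_gen u) = alpha (raag_gen u)].
Proof.
move=> aa wv dwv nf lt.
pose b := exponent y (alpha (raag_gen v)); pose a := exponent y (alpha (raag_gen w)).
have expl (e : bool) z : exponent z (alpha (lett (v, e))) =
    (if e then - exponent z (alpha (raag_gen v)) else exponent z (alpha (raag_gen v)))%R.
  by case: e; rewrite ?lett_genV ?autV ?exponentV.
(* entries of the same sign are subtracted, and e = true stands for the inverse *)
pose e : bool := ((0 < a) == (0 < b))%R.
have [beta [ba bH bw bu]] := transvect e aa wv dwv nf.
exists beta; split=> //.
  rewrite bw !exponentM expl -/a -/b; move: lt; rewrite -/a -/b /e.
  by case: (boolP (0 < a)%R); case: (boolP (0 < b)%R) => /=; lia.
by move=> z hz; rewrite bw !exponentM expl hz; case: (e); lia.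
Qed.

(** The smaller of two nonzero entries of the row, an odd and an even one, is used
to reduce the larger one.  Using an off-diagonal column to reduce the diagonal one
needs [y] to be dominated by that column; this is where the order of the rows,
minimal vertices first, enters. *)
Lemma row_step_in_H alpha y (D : {set Gamma}) : admissible alpha ->
  abelian_vertex y -> y \notin D ->
  (forall u, abelian_vertex u -> u \notin D -> dominated_by u y -> dominated_by y u) ->
  (forall d, d \in D -> row_cleared alpha d) ->
  (forall beta, admissible beta -> (forall d, d \in D -> row_cleared beta d) ->
     row_cleared beta y -> H beta) -> H alpha.
Proof.
move=> aa aby yD ymin rD done_y.
have [n] := ubnP (\sum_(u | abelian_vertex u) `|exponent y (alpha (raag_gen u))|)%N.
elim: n alpha aa rD => // n IH alpha aa rD lt.
case: (EM (row_cleared alpha y)) => [ry|nry]; first exact: done_y.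
have step v w : abelian_vertex w -> v \notin D -> w != v -> dominated_by w v ->
    ~ fixed w -> (0 < `|exponent y (alpha (raag_gen v))|
                  < `|exponent y (alpha (raag_gen w))|)%N ->
    abelian_vertex v -> H alpha.
  move=> abw vD wv dwv nf hlt abv.
  have [beta [ba bH blt bz bu]] := euclid_step aa wv dwv nf hlt.
  apply: bH; apply: IH => //.
    move=> d dD u abu ud; have dv : v != d by apply: contraNneq vD => ->.
    have [eu|uw] := eqVneq u w; last by rewrite bu // rD.
    by rewrite eu in ud *; rewrite bz; apply: rD.
  apply: leq_trans (_ : \sum_(u | abelian_vertex u) `|exponent y (alpha (raag_gen u))| <= n)%N; last by [].
  rewrite (bigD1 w) //= [X in (_ < X)%N](bigD1 w) //= -addSn leq_add //.
  by apply: leq_sum => u /andP[_ /bu ->].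
have odd_y := diagonal_odd y aa.1.
have not_fixed u (p : int) : exponent y (alpha (raag_gen u)) = p ->
    p <> ((u == y)%:Z)%R -> ~ fixed u.
  by move=> e np fu; apply: np; rewrite -e (aa.2 u fu) exponent_gen.
(* an entry larger than the diagonal one is reduced by column y itself *)
have big u : abelian_vertex u -> u != y ->
    (`|exponent y (alpha (raag_gen y))| < `|exponent y (alpha (raag_gen u))|)%N -> H alpha.
  move=> abu uy lt'; apply: (step y u) => //.
  - apply: (support_dominates aa.1); first by rewrite eq_sym.
    by apply: cnt_exponent => e0; rewrite e0 in lt'.
  - by apply: not_fixed (erefl _) _; rewrite (negPf uy) => e0; rewrite e0 in lt'.
  - by rewrite lt' andbT; case: absz odd_y.
case: (EM (exists u, [/\ abelian_vertex u, u \notin D, u != y &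
    exponent y (alpha (raag_gen u)) <> 0%R])) => [[u [abu uD uy nz]]|none].
  have even_u := offdiagonal_even aa.1 uy.
  case: (ltngtP `|exponent y (alpha (raag_gen y))|%N `|exponent y (alpha (raag_gen u))|%N).
  - exact: big.
  - move=> lt'; have dom_uy : dominated_by u y.
      by apply: (support_dominates aa.1 _ (cnt_exponent nz)); rewrite eq_sym.
    apply: (step u y) => //; first by rewrite eq_sym.
    + exact: ymin.
    + by apply: not_fixed (erefl _) _; rewrite eqxx => e1; rewrite e1 in lt'; move: lt' nz; lia.
    + by rewrite lt' andbT absz_gt0; apply/eqP.
  - by move=> e; rewrite e even_u in odd_y.
(* all undone columns vanish in this row, so only columns of D can be nonzero *)
have unit_y : `|exponent y (alpha (raag_gen y))|%N = 1%N.
  apply: (diagonal_unit aa.1 aby yD rD) => u abu uD uy.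
  by apply: contrapT => nz; apply: none; exists u.
move/existsNP: nry => [u /not_implyP[abu /not_implyP[uy nz]]].
apply: (big u) => //; have := offdiagonal_even aa.1 uy.
by rewrite unit_y; case: exponent nz => [[|[|m]]|[|m]].
Qed.

(** An image that only involves commuting letters is determined by its exponents. *)
Lemma abelian_cleared_in_H alpha : admissible alpha ->
  (forall d, abelian_vertex d -> row_cleared alpha d) -> H alpha.
Proof.
move=> aa rows; apply: abelian_signed_in_H => // v abv.
have only z : (0 < cnt z (alpha (raag_gen v)))%N -> z = v.
  move=> cz; apply/eqP/negPn/negP => zv.
  have dvz := support_dominates aa.1 zv cz.
  have iso : isolated z (alpha (raag_gen v)).
    move=> t ct tz; have [->|tv] := eqVneq t v.
      by rewrite adj_sym; apply: (abelian_vertexP _ abv).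
    have /fintype.subsetP/(_ z) := support_dominates aa.1 tv ct.
    rewrite !inE (abelian_vertexP _ abv z dvz zv) => /(_ isT).
    by rewrite eq_sym (negPf tz) /= adj_sym.
  have := isolated_exponent iso.
  rewrite (rows z (abelian_vertex_up abv dvz) v abv) 1?eq_sym //.
  by move=> e; rewrite -e in cz.
rewrite (len_single only) -isolated_exponent; last first.
  by move=> z /only ->; rewrite eqxx.
apply: (diagonal_unit (D := [set d | abelian_vertex d & d != v]%SET) aa.1 abv).
- by rewrite inE eqxx andbF.
- by move=> d; rewrite inE => /andP[abd _]; apply: rows.
- by move=> u abu; rewrite inE abu /= negbK => /eqP->; rewrite eqxx.
Qed.

(** The next row is one with the fewest vertices below it, which makes it minimal
for domination among the rows not yet cleared. *)
Lemma rows_cleared_in_H alpha (D : {set Gamma}) : admissible alpha ->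
  (forall d, d \in D -> row_cleared alpha d) -> H alpha.
Proof.
have [n] := ubnP #|~: D|; elim: n D alpha => // n IH D alpha lt aa rD.
pose todo v := abelian_vertex v && (v \notin D).
case: (pickP todo) => [v0 tv0|none]; last first.
  apply: abelian_cleared_in_H => // d abd; apply: rD.
  by have := none d; rewrite /todo abd => /negbFE.
case: (arg_minnP (fun v => #|[set t | dominated_by t v]%SET|) tv0) => y /andP[aby yD] ymin.
apply: (row_step_in_H aa aby yD _ rD) => [u abu uD uy|beta ba rDb rb]; last first.
  apply: (IH (y |: D)%SET) => //.
    apply: leq_trans (_ : #|~: D| <= n)%N; last by [].
    apply/proper_card; rewrite properC.
    by apply/fintype.properP; split; [apply: finset.subsetUr|exists y; rewrite // !inE eqxx].
  by move=> d; rewrite !inE => /orP[/eqP->|/rDb].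
have sub : [set t | dominated_by t u]%SET \subset [set t | dominated_by t y]%SET.
  by apply/fintype.subsetP => t; rewrite !inE => tu; apply: dominated_trans tu uy.
have /eqP e : [set t | dominated_by t u]%SET == [set t | dominated_by t y]%SET.
  by rewrite eqEcard sub ymin // /todo abu.
have : y \in [set t | dominated_by t y]%SET by rewrite inE dominated_refl.
by rewrite -e inE.
Qed.

Theorem admissible_in_H alpha : admissible alpha -> H alpha.
Proof. by move=> aa; apply: (rows_cleared_in_H (D := finset.set0)) => // d; rewrite inE. Qed.
End Generation.

(** * The theorem *)

Section SubgroupFacts.
Variable G : groupType.

Lemma generated_subgroup_is_subgroup (S : set G) : is_subgroup (generated_subgroup S).
Proof.
split=> [T [[]]//|x y hx hy T hT|x hx T hT].
  by case: (hT) => -[_ TM _] _; apply: TM; [apply: hx|apply: hy].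
by case: (hT) => -[_ _ TV] _; apply: TV; apply: hx.
Qed.

Lemma generated_subgroup_sub (S : set G) : S `<=` generated_subgroup S.
Proof. by move=> x Sx T [_]; apply. Qed.
End SubgroupFacts.

Section MainTheorem.
Variable Gamma : sgraph.
Implicit Types (u w x : Gamma) (alpha : Defs.aut (raag Gamma)).

Lemma fixes_first_subgroup (n : nat) (v : 'I_n -> Gamma) k :
  is_subgroup (fixes_first v k).
Proof.
split=> [//|a b fa fb i ik|a fa i ik]; first by rewrite aut_mulE fb ?fa.
by apply: (can_inj (autK a)); rewrite autVK fa.
Qed.

Lemma PiA_stab_subgroup (n : nat) (v : 'I_n -> Gamma) k :
  is_subgroup (PiA_stab v k).
Proof.
have [P1 PM PV] := PiA_subgroup Gamma; have [F1 FM FV] := fixes_first_subgroup v k.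
split=> [|a b [pa fa] [pb fb]|a [pa fa]]; first by split.
  by split; [apply: PM|apply: FM].
by split; [apply: PV|apply: FV].
Qed.

Lemma diagram_PiA alpha : diagram_automorphism alpha -> PiA alpha.
Proof. by case=> s _ h u; exists [:: (s u, false)]. Qed.

Lemma inversion_PiA alpha : inversion alpha -> PiA alpha.
Proof.
case=> w [hw h] u; have [->|uw] := eqVneq u w.
  by exists [:: (w, true)]; split; rewrite // hw -lett_genV.
by exists [:: (u, false)]; split; rewrite // h.
Qed.

Lemma dominated_elementary_PiA alpha :
  dominated_elementary_palindromic alpha -> PiA alpha.
Proof.
case=> u [w [_ _ hu h]] x; have [->|xu] := eqVneq x u; last first.
  by exists [:: (x, false)]; split; rewrite // h.
exists [:: (w, false); (u, false); (w, false)]; split=> //.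
by rewrite hu !class_cons class_nil mulg1 mulgA.
Qed.
End MainTheorem.

Theorem theorem3p11 (Gamma : sgraph) (n : nat) (v : 'I_n -> Gamma)
    (v_bij : bijective v) (k : nat) (k_gt0 : (1 <= k)%N) (k_le_n : (k <= n)%N) :
  @PiA_stab Gamma n v k =
  generated_subgroup
    ((@diagram_automorphism Gamma `|` @inversion Gamma
        `|` @dominated_elementary_palindromic Gamma)
     `&` @fixes_first Gamma n v k).
Proof.
apply/seteqP; split=> [alpha [pal fix_alpha]|]; last first.
  apply: smallest_sub; first exact: PiA_stab_subgroup.
  move=> alpha [[[]|] gen fix_alpha]; split=> //.
  - exact: diagram_PiA.
  - exact: inversion_PiA.
  - exact: dominated_elementary_PiA.
set S := (X in generated_subgroup X).
pose fixed u := exists2 i : 'I_n, (i < k)%N & v i = u.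
have fixingE beta : fixing fixed beta <-> fixes_first v k beta.
  by split=> [h i ik|h _ [i ik <-]]; [apply: h; exists i|apply: h].
have genH := generated_subgroup_is_subgroup S.
have [s os] := PiA_over pal.
have sfix u : fixed u -> s u = u.
  case=> i ik <-; have [_ ps] := palindromic_over_gen (v i) os.
  by apply/eqP; rewrite -ps fix_alpha // (par_lett _ (v i, false)) eqxx.
have gs := over_graph_automorphism os.
have gsV : graph_automorphism (s^-1)%g.
  by move=> u w; rewrite -gs !permKV.
have [delta hd] := diagram_exists gsV.
have fd : fixing fixed delta.
  by move=> u fu; rewrite hd -{1}(sfix u fu) permK.
have od : palindromic_over (s^-1)%g delta.
  by apply: palindromic_over_gens => [u|u x]; rewrite hd;
    [apply: (rho_lett (_, false))|apply: (par_lett _ (_, false))].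
have Hd : generated_subgroup S delta.
  by apply: generated_subgroup_sub; split; [left; left; exists (s^-1)%g|apply/fixingE].
apply: (in_H_mulr genH Hd).
apply: (@admissible_in_H _ fixed).
- exact: genH.
- by move=> beta ib fb; apply: generated_subgroup_sub; split; [left; right|apply/fixingE].
- by move=> beta tb fb; apply: generated_subgroup_sub; split; [right|apply/fixingE].
split; first by have := palindromic_overM os od; rewrite mulVg.
move=> u fu; rewrite aut_mulE fd //.
by case: fu => i ik <-; apply: fix_alpha.
Qed.
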